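(* Let $s>0$ and let $(\mathcal{X},d_{\mathcal{X}})$ be an Ahlfors $s$-regular compact metric space, i.e. there are a Borel probability measure $\rho$ supported on $\mathcal{X}$ and a constant $c\ge 1$ with $c^{-1}r^s\le \rho(\overline{B}(x,r))\le c r^s$ for all $x\in\mathcal{X}$ and $0<r\le \operatorname{diam}\mathcal{X}$. Equip $\mathcal{X}^{\mathbb{N}_0}$ with the metric $d(\underline{x},\underline{y})=\sum_{n\in\mathbb{N}_0}2^{-n}d_{\mathcal{X}}(x_n,y_n)$ and let $\sigma$ be the left shift. Let $\varphi:\mathcal{X}^{\mathbb{N}_0}\to\mathbb{R}$ be a Hölder continuous function depending on the first two coordinates. Then $$\overline{\mathrm{mdim}}_M(\mathcal{X}^{\mathbb{N}_0},\sigma,d,\varphi)=\sup_{\mu\in\mathcal{M}_\sigma(\mathcal{X}^{\mathbb{N}_0})}\Big(\underline{\mathrm{rdim}}(\mathcal{X}^{\mathbb{N}_0},\sigma,d,\mu)+\int\varphi\,d\mu\Big)=\sup_{\mu\in\mathcal{M}_\sigma(\mathcal{X}^{\mathbb{N}_0})}\Big(\overline{\mathrm{rdim}}(\mathcal{X}^{\mathbb{N}_0},\sigma,d,\mu)+\int\varphi\,d\mu\Big),$$ where $\overline{\mathrm{mdim}}_M(\mathcal{X}^{\mathbb{N}_0},\sigma,d,\varphi)$ is the (upper) mean metric dimension with potential.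
   Context: $\mathbb{N}_0=\{0,1,2,\dots\}$; $\overline{B}(x,r)$ is the closed ball; $\sigma((x_n)_{n\ge0})=(x_{n+1})_{n\ge0}$; $\mathcal{M}_\sigma(\mathcal{X}^{\mathbb{N}_0})$ is the set of $\sigma$-invariant Borel probability measures on $\mathcal{X}^{\mathbb{N}_0}$. $\varphi$ depends on the first two coordinates if $\varphi(\underline{x})=\varphi(\underline{y})$ whenever $x_0=y_0$ and $x_1=y_1$. Hölder continuity is with respect to $d$. Below, $T:\mathcal{Y}\to\mathcal{Y}$ is a continuous map on a compact metric space $(\mathcal{Y},d)$, $\varphi:\mathcal{Y}\to\mathbb{R}$ is continuous, $d_N(x,y)=\max_{0\le n\le N-1}d(T^nx,T^ny)$ and $S_N\varphi(x)=\sum_{n=0}^{N-1}\varphi(T^nx)$. Mean metric dimension with potential: for $\varepsilon>0$, $\#(\mathcal{Y},d,\varphi,\varepsilon)$ is the infimum of $\sum_{i=1}^n\varepsilon^{-\sup_{U_i}\varphi}$ over all finite covers $\mathcal{Y}=\bigcup_{i=1}^nU_i$ with $\operatorname{diam}U_i<\varepsilon$ (with respect to $d$) for every $i$. Put $S(\mathcal{Y},T,d,\varphi,\varepsilon)=\lim_{N\to\infty}\frac1N\log\#(\mathcal{Y},d_N,S_N\varphi,\varepsilon)$ and $\overline{\mathrm{mdim}}_M(\mathcal{Y},T,d,\varphi)=\limsup_{\varepsilon\to0}S(\mathcal{Y},T,d,\varphi,\varepsilon)/|\log\varepsilon|$. Mutual information: for random variables $X,Y$ on a common probability space $(\Omega,\mathbb{P})$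 with values in measurable spaces, $I(X;Y)$ is the supremum of $\sum_{m,n}\mathbb{P}((X,Y)\in P_m\times Q_n)\log\frac{\mathbb{P}((X,Y)\in P_m\times Q_n)}{\mathbb{P}(X\in P_m)\mathbb{P}(Y\in Q_n)}$ over finite measurable partitions $\{P_m\},\{Q_n\}$ of the two target spaces (with $0\log(0/a)=0$ for all $a\ge 0$). Rate distortion dimension: let $\mu$ be a $T$-invariant Borel probability measure on $\mathcal{Y}$. For $\varepsilon>0$, $R(d,\mu,\varepsilon)$ is the infimum of $I(X;Y)/n$ over all $n\in\mathbb{N}$ and all random variables $X$ and $Y=(Y_0,\dots,Y_{n-1})$ on some common probability space such that $X$ takes values in $\mathcal{Y}$ with law $\mu$, each $Y_k$ takes values in $\mathcal{Y}$, and $\mathbb{E}\big(\frac1n\sum_{k=0}^{n-1}d(T^kX,Y_k)\big)<\varepsilon$. Then $\overline{\mathrm{rdim}}(\mathcal{Y},T,d,\mu)=\limsup_{\varepsilon\to0}R(d,\mu,\varepsilon)/|\log\varepsilon|$ and $\underline{\mathrm{rdim}}(\mathcal{Y},T,d,\mu)=\liminf_{\varepsilon\to0}R(d,\mu,\varepsilon)/|\log\varepsilon|$. *)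

(* Defs.v *)
From HB Require Import structures.
From mathcomp Require Import all_boot all_order all_algebra.
From mathcomp Require Import all_classical all_reals all_analysis.

Set Implicit Arguments.
Unset Strict Implicit.
Unset Printing Implicit Defensive.

Import Order.TTheory GRing.Theory Num.Theory.
Import numFieldNormedType.Exports.

Local Open Scope classical_set_scope.
Local Open Scope ring_scope.

(* The base point is only there because the library's measurable types are
   pointed; a space carrying a probability measure is nonempty anyway. *)
#[short(type="pointedMetricType")]
HB.structure Definition PointedMetric (R : numDomainType) :=
  {M of Metric R M & isPointed M}.

(* Distances are passed as explicit functions d : Y -> Y -> R, since both the
   metric d and the dynamical metrics d_N live on the same carrier Y. *)

Definition diam {R : realType} {Y : Type} (d : Y -> Y -> R) (U : set Y)
    : \bar R :=
  ereal_sup [set (d xy.1 xy.2)%:E | xy in U `*` U].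

Definition open_for {R : realType} {Y : Type} (d : Y -> Y -> R)
    : set (set Y) :=
  [set A | forall x, A x ->
     exists2 e : R, 0 < e & forall y, d x y < e -> A y].

Notation borel d := (g_sigma_algebraType (open_for d)).

(* Measures are total set functions, hence the restriction to measurable A. *)
Definition invariant_measure {R : realType} {Y : pointedType} (d : Y -> Y -> R)
    (T : Y -> Y) (mu : probability (borel d) R) : Prop :=
  forall A : set (borel d), measurable A -> mu (T @^-1` A) = mu A.

Definition holder_continuous {R : realType} {Y : Type} (d : Y -> Y -> R)
    (phi : Y -> R) : Prop :=
  exists C a : R, 0 < a <= 1 /\
    forall x y, `|phi x - phi y| <= C * d x y `^ a.

Section MeanMetricDimension.
Context {R : realType} {Y : Type}.
Implicit Types (d : Y -> Y -> R) (T : Y -> Y) (phi : Y -> R).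

Definition dyn_dist d T (N : nat) (x y : Y) : R :=
  \big[Num.max/0]_(n < N) d (iter n T x) (iter n T y).

Definition birkhoff_sum T phi (N : nat) (x : Y) : R :=
  \sum_(n < N) phi (iter n T x).

(* [sup] is the real supremum, meaningful for phi bounded on U i, which is
   automatic for continuous phi on a compact space.  As sup set0 = 0, an empty
   U i adds e `^ 0 = 1 to the sum and does not affect the infimum. *)
Definition weighted_cover_number d phi (e : R) : \bar R :=
  ereal_inf [set r | exists (n : nat) (U : 'I_n -> set Y),
    [/\ \bigcup_i U i = [set: Y],
        forall i, (diam d (U i) < e%:E)%E &
        r = (\sum_(i < n) e `^ (- sup [set phi x | x in U i]))%:E]].

Definition entropy_at_scale d T phi (e : R) : \bar R :=
  limn (fun N : nat => ((N%:R^-1)%:E *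
    lne (weighted_cover_number (dyn_dist d T N) (birkhoff_sum T phi N) e))%E).

Definition upper_mmdim d T phi : \bar R :=
  limf_esup (fun e : R => (entropy_at_scale d T phi e * (`|ln e|^-1)%:E)%E)
    0^'+.

End MeanMetricDimension.

(* 0 * ln (0 / a) = 0 holds for all a since ln is total. *)
Definition mutual_information {R : realType} {d d1 d2 : measure_display}
    {Omega : measurableType d} {T1 : measurableType d1}
    {T2 : measurableType d2} (P : probability Omega R)
    (X : Omega -> T1) (Y : Omega -> T2) : \bar R :=
  ereal_sup [set r | exists (a b : nat)
      (p : 'I_a -> set T1) (q : 'I_b -> set T2),
    [/\ partition setT p setT /\ (forall i, measurable (p i)),
        partition setT q setT /\ (forall j, measurable (q j)) &
        r = (\sum_(i < a) \sum_(j < b)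
          (let pij := fine (P (X @^-1` p i `&` Y @^-1` q j)) in
           pij * ln (pij / (fine (P (X @^-1` p i)) *
                            fine (P (Y @^-1` q j))))))%:E]].

Section RateDistortionDimension.
Context {R : realType} {Y : pointedType}.
Variables (d : Y -> Y -> R) (T : Y -> Y) (mu : probability (borel d) R).

Definition rate_distortion (e : R) : \bar R :=
  ereal_inf [set r | exists (n : nat) (dO : measure_display)
      (Omega : measurableType dO) (P : probability Omega R)
      (X : {RV P >-> borel d}) (Z : {RV P >-> n.-tuple (borel d)}),
    [/\ (0 < n)%N,
        forall A : set (borel d), measurable A -> P (X @^-1` A) = mu A,
        ('E_P[fun w => (n%:R^-1 *
            \sum_(k < n) d (iter k T (X w)) (tnth (Z w) k))%R] < e%:E)%E &
        r = (mutual_information P X Z * (n%:R^-1)%:E)%E]].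

Definition upper_rdim : \bar R :=
  limf_esup (fun e : R => (rate_distortion e * (`|ln e|^-1)%:E)%E) 0^'+.

Definition lower_rdim : \bar R :=
  limf_einf (fun e : R => (rate_distortion e * (`|ln e|^-1)%:E)%E) 0^'+.

End RateDistortionDimension.

(* The closed ball is {y | d x y <= r}, not the library's [closed_ball], which
   is the closure of the open ball. *)
Definition metric_closed_ball {R : realType} {Y : Type} (d : Y -> Y -> R)
    (x : Y) (r : R) : set Y := [set y | d x y <= r].

Definition ahlfors_regular {R : realType} (X : pointedMetricType R) (s : R)
    : Prop :=
  exists (rho : probability (g_sigma_algebraType (@open X)) R) (c : R),
    1 <= c /\
    forall (x : X) (r : R), 0 < r -> (r%:E <= diam (@mdist R X) setT)%E ->
      ((c^-1 * r `^ s)%:E <= rho (metric_closed_ball mdist x r)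
        <= (c * r `^ s)%:E)%E.

Section SequenceSpace.
Context {R : realType} {X : pointedMetricType R}.

Definition seq_dist (x y : nat -> X) : R :=
  limn (series (fun n => 2 ^- n * mdist (x n) (y n))).

Definition left_shift (x : nat -> X) : nat -> X := fun n => x n.+1.

Definition depends_on_first_two (phi : (nat -> X) -> R) : Prop :=
  forall x y : nat -> X, x 0%N = y 0%N -> x 1%N = y 1%N -> phi x = phi y.

End SequenceSpace.

(* Main.v *)
(** All three quantities equal [s + beta], where [beta], the limit of
    [sup S_N phi / N], is the largest value of the integral of [phi] over
    invariant measures.  (On a one-point space read [0] for [s].)

    At scale [e] the space [X] has about [e ^ - s] cells, so products of cells on
    [N] coordinates give [#(d_N, S_N phi, e) <= e ^ (- N (s + beta + o(1)))].
    Conversely let [x] be an orbit with [S_N phi(x)] close to [N beta].  For a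
    fixed radius [t], choosing for every [n < N] one of about [(t / e) ^ s]
    [e]-separated points of the ball of radius [t] around [x n] produces
    [(t / e) ^ (s N)] sequences, no two of which lie in the same member of a
    cover, and whose Birkhoff sums are close to [N beta].

    For every invariant measure the upper rate distortion dimension is at most
    [s], because coding coordinates by cells is an admissible reproduction, and
    the integral of [phi] is at most [beta].  To approach [s + beta] from below,
    surround a near-maximal periodic orbit by independent random points: the
    coordinate near [x n] is the limit along a tree of nested separated points
    whose branches are chosen by independent uniform digits.  The resulting law,
    averaged over the phases of the orbit, is invariant, it gives mass at most
    about [e ^ ((s - eta) n)] to every product of [n] cells of size [e], and a
    Fano-type inequality turns this into a lower bound for the rate distortion
    function. *)

Require Import Defs.
From HB Require Import structures.
From mathcomp Require Import all_boot all_order all_algebra.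
From mathcomp Require Import all_classical all_reals all_analysis.
From mathcomp Require Import measurable_realfun lra ring zify.

Set Implicit Arguments.
Unset Strict Implicit.
Unset Printing Implicit Defensive.

Import Order.TTheory GRing.Theory Num.Theory.
Import numFieldNormedType.Exports.

Local Open Scope classical_set_scope.
Local Open Scope ring_scope.

(** * Subadditive sequences, limits at 0+ and the metric of the sequence space *)

(** The obstacle in the lower bound is that the lower rate distortion dimension is a liminf: one
    measure must be spread out at all small scales at once. Points separated at a single scale,
    which suffice against covers, control that scale only; hence the tree. Each level of the tree
    loses a constant factor in the number of branches, so the contraction [lam] is taken small
    enough for this factor to cost at most [eta] in the exponent.

    All digits are read from one Lebesgue-distributed number, so no infinite product measure has to
    be built. The coordinates own disjoint sets of digit positions, numbered so that the shift
    becomes an injective renumbering, and such a renumbering preserves the law of the digits.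

    The dependence of [phi] on two coordinates enters when a long orbit segment is closed up to a
    periodic orbit: a single term of its Birkhoff sum reads across the seam, so the cost is bounded
    independently of the length. *)

Lemma fekete (R : realType) (u : nat -> R) (b : R) :
  (forall m n, u (m + n)%N <= u m + u n) -> (forall n, n%:R * b <= u n) ->
  exists2 l : R, (fun n => n%:R^-1 * u n) @ \oo --> l &
    forall n, n%:R * l <= u n.
Proof.
move=> usub ub; pose A := [set x | exists2 n, (0 < n)%N & x = n%:R^-1 * u n].
have lbA : lbound A b.
  by move=> _ [n n0 ->]; rewrite ler_pdivlMl ?ltr0n//.
have A0 : has_inf A by split; [exists (1%:R^-1 * u 1%N); exists 1%N|exists b].
have u0 : 0 <= u 0%N by have := usub 0%N 0%N; rewrite addn0; lra.
have infle n : n%:R * inf A <= u n.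
  case: n => [|n]; first by rewrite mul0r.
  rewrite -ler_pdivlMl ?ltr0n//; apply: ge_inf; first by exists b.
  by exists n.+1.
exists (inf A) => //.
apply/cvgrPdist_le => e e0.
have e20 : 0 < e / 2 by rewrite divr_gt0.
have [_ [N N0 ->] uN] := inf_adherent e20 A0.
set l := inf A in uN infle *.
pose B := \sum_(i < N) `|u i|.
have uB n : (n < N)%N -> u n <= B.
  move=> nN; rewrite /B (bigD1 (Ordinal nN))//= (le_trans (ler_norm _))// lerDl.
  exact: sumr_ge0.
have umul q r : u (q * N + r)%N <= q%:R * u N + u r.
  elim: q => [|q IH]; first by rewrite mul0n mul0r add0r add0n.
  rewrite mulSn -addnA (le_trans (usub _ _))// -natr1; lra.
have N0' : (0 : R) < N%:R by rewrite ltr0n.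
(* Write [n = q * N + r] with [r < N]. [C] bounds [u r] together with the share [r * (l + e / 2)] by
   which [q * N] falls short of [n]; beyond [C / (e / 2)] the spare half of [e] absorbs it. *)
pose C := N%:R * `|l + e / 2| + B.
near=> n.
have n0 : (0 < n)%N by near: n; exists 1%N.
have n0' : (0 : R) < n%:R by rewrite ltr0n.
have nC : C / (e / 2) <= n%:R by near: n; exact: nbhs_infty_ger.
rewrite distrC ger0_norm; last by rewrite subr_ge0 ler_pdivlMl// infle.
rewrite lerBlDl ler_pdivrMl//.
rewrite (divn_eq n N) (le_trans (umul _ _))//.
have uN' : u N <= N%:R * (l + e / 2) by rewrite -ler_pdivrMl// ltW.
have := uB _ (ltn_pmod n N0).
have : (n %/ N)%:R * u N <= (n %/ N)%:R * (N%:R * (l + e/2)).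
  by rewrite ler_wpM2l.
have nE : (n%:R : R) = (n %/ N)%:R * N%:R + (n %% N)%:R.
  by rewrite -natrM -natrD -divn_eq.
rewrite -divn_eq.
have : - ((n %% N)%:R * (l + e/2)) <= N%:R * `|l + e/2|.
  rewrite -mulrN; apply: (@le_trans _ _ ((n %% N)%:R * `|l + e/2|)).
    by rewrite ler_wpM2l// -normrN ler_norm.
  by rewrite ler_wpM2r// ler_nat ltnW// ltn_pmod.
move: nC; rewrite ler_pdivrMr// /C => nC.
rewrite mulrA; have : n%:R * (l + e) = (n %/ N)%:R * N%:R * (l + e/2) +
  (n %% N)%:R * (l + e / 2) + n%:R * (e / 2) by rewrite nE; field.
lra.
Unshelve. all: by end_near. Qed.

Section limf.
Context {R : realType}.
Implicit Types (f : R -> \bar R) (a : R).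

Lemma limf_esup_le f a : (forall eta : R, 0 < eta ->
    \forall e \near 0^'+, (f e <= (a + eta)%:E)%E) ->
  (limf_esup f 0^'+ <= a%:E)%E.
Proof.
move=> H; apply/lee_addgt0Pr => eta eta0.
rewrite -EFinD limf_esupE; apply: (le_trans _ (_ : ereal_sup [set f x | x in [set x | (f x <= (a + eta)%:E)%E]] <= _))%E.
  by apply: ereal_inf_lbound; exists [set x | (f x <= (a + eta)%:E)%E] => //; exact: H.
by apply: ge_ereal_sup => _ [x /= xa <-].
Qed.

Lemma limf_esup_ge f a : (forall eta : R, 0 < eta ->
    \forall e \near 0^'+, ((a - eta)%:E <= f e)%E) ->
  (a%:E <= limf_esup f 0^'+)%E.
Proof.
move=> H; apply/lee_subgt0Pr => eta eta0.
rewrite -EFinB limf_esupE; apply: le_ereal_inf_tmp => _ [V V0 <-].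
have /filter_ex[x [Vx fx]] : \forall e \near 0^'+, V e /\ ((a - eta)%:E <= f e)%E.
  exact: filterI V0 (H _ eta0).
by apply: (le_trans fx); apply: ereal_sup_ubound; exists x.
Qed.

Lemma limf_einf_ge f a : (forall eta : R, 0 < eta ->
    \forall e \near 0^'+, ((a - eta)%:E <= f e)%E) ->
  (a%:E <= limf_einf f 0^'+)%E.
Proof.
move=> H; rewrite /limf_einf leeNr -EFinN; apply: limf_esup_le => eta eta0.
apply: filterS (H _ eta0) => x fx.
by rewrite leeNl -EFinN; apply: le_trans fx; rewrite lee_fin; lra.
Qed.

Lemma limf_einf_le_esup f : (limf_einf f 0^'+ <= limf_esup f 0^'+)%E.
Proof.
rewrite !limf_esupE /limf_einf leeNl limf_esupE.
apply: le_ereal_inf_tmp => _ [V V0 <-].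
rewrite leeNl; apply: le_ereal_inf_tmp => _ [W W0 <-].
have /filter_ex[x [Vx Wx]] : \forall e \near 0^'+, V e /\ W e.
  exact: filterI.
rewrite leeNl (@le_trans _ _ (- f x)%E)//.
  by rewrite leeN2; apply: ereal_sup_ubound; exists x.
by apply: ereal_sup_ubound; exists x.
Qed.

End limf.

Lemma exists_geometric_le (R : realType) (C e : R) : 0 < e ->
  exists m, 2 ^- m * C <= e.
Proof.
move=> e0; have /cvgrPdist_le : 2^-1 ^+ n @[n --> \oo] --> (0 : R).
  by apply: cvg_expr; rewrite ger0_norm ?invr_ge0// invf_lt1// ltr1n.
have C0 : 0 < `|C| + 1 by rewrite ltr_wpDl.
move=> /(_ _ (divr_gt0 e0 C0))[m _ /(_ m (leqnn m))].
rewrite sub0r normrN ger0_norm ?exprn_ge0 ?invr_ge0// exprVn ler_pdivlMr// => h.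
exists m; apply: le_trans h; rewrite ler_wpM2l ?invr_ge0 ?exprn_ge0//.
by rewrite (le_trans (ler_norm C))// lerDl.
Qed.

Section seqdist.
Context {R : realType} {X : pointedMetricType R}.
Implicit Types x y : nat -> X.
Variable D : R.
Hypothesis mD : forall a b : X, mdist a b <= D.
Local Notation T := (@left_shift R X).
Local Notation sd := (@seq_dist R X).

Lemma iter_shift k x n : iter k T x n = x (n + k)%N.
Proof. by elim: k n => [|k IH] n; rewrite ?addn0// iterS/left_shift/= IH addnS. Qed.

(** [seq_dist] is a [limn], which carries information only once the series is known to converge; the
    bound [D] provides this. *)
Lemma seq_dist_cvg x y :
  cvgn (series (fun n => 2 ^- n * mdist (x n) (y n) : R)).
Proof.
apply: (@series_le_cvg _ _ (geometric D 2^-1)).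
- by move=> n; rewrite mulr_ge0// ?invr_ge0 ?exprn_ge0// mdist_ge0.
- by move=> n; rewrite /geometric/= mulr_ge0 ?exprn_ge0 ?invr_ge0// (le_trans _ (mD (x 0%N) (x 0%N)))// mdist_ge0.
- by move=> n; rewrite /geometric/= mulrC exprVn ler_wpM2r// invr_ge0 exprn_ge0.
- by apply: is_cvg_geometric_series; rewrite ger0_norm ?invr_ge0// invf_lt1// ltr1n.
Qed.

Lemma seq_dist_ge_term x y k : 2 ^- k * mdist (x k) (y k) <= sd x y.
Proof.
rewrite /seq_dist; apply: (@le_trans _ _ (series (fun n => 2 ^- n * mdist (x n) (y n)) k.+1)).
  rewrite /series/= big_nat_recr//= lerDr sumr_ge0// => i _.
  by rewrite mulr_ge0// ?invr_ge0 ?exprn_ge0// mdist_ge0.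
apply: nondecreasing_cvgn_le; last exact: seq_dist_cvg.
apply/nondecreasing_seqP => n; rewrite /series/= big_nat_recr//= lerDl.
by rewrite mulr_ge0// ?invr_ge0 ?exprn_ge0// mdist_ge0.
Qed.

Lemma seq_dist_ge0 x y : 0 <= sd x y.
Proof.
by apply: le_trans (seq_dist_ge_term x y 0); rewrite expr0 invr1 mul1r mdist_ge0.
Qed.

Lemma seq_dist_ge k x y : mdist (x k) (y k) <= sd (iter k T x) (iter k T y).
Proof.
have := seq_dist_ge_term (iter k T x) (iter k T y) 0.
by rewrite !iter_shift expr0 invr1 mul1r add0n.
Qed.

Lemma seq_dist_rec x y : sd x y = mdist (x 0%N) (y 0%N) + 2^-1 * sd (T x) (T y).
Proof.
rewrite {1}/seq_dist; apply/cvg_lim => //; rewrite -cvg_shiftS/=.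
rewrite (_ : (fun n => _) = (fun n => mdist (x 0%N) (y 0%N) +
    2^-1 * series (fun n => 2 ^- n * mdist (T x n) (T y n)) n)).
  by apply: cvgD; [exact: cvg_cst|apply: cvgMl_tmp; exact: seq_dist_cvg].
apply/funext => n.
rewrite /series/= big_nat_recl//= expr0 invr1 mul1r; congr (_ + _).
rewrite mulr_sumr; apply: eq_bigr => i _.
by rewrite /left_shift exprS invfM mulrA.
Qed.

Lemma seq_dist_le x y (r : R) : (forall n, mdist (x n) (y n) <= r) ->
  sd x y <= 2 * r.
Proof.
move=> xyr; rewrite /seq_dist.
apply: limr_le; first exact: seq_dist_cvg.
near=> n.
have -> : 2 * r = r / (1 - 2^-1) by field.
apply: (@le_trans _ _ (series (geometric r 2^-1) n)).
  rewrite /series/=; apply: ler_sum => i _.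
  by rewrite mulrC exprVn ler_wpM2r// invr_ge0 exprn_ge0.
have r0 : 0 <= r by rewrite (le_trans _ (xyr 0%N))// mdist_ge0.
rewrite geometric_seriesE; last by rewrite lt_eqF// invf_lt1// ltr1n.
rewrite ler_wpM2r ?invr_ge0 ?subr_ge0 ?invf_le1 ?ler1n//.
by rewrite ler_piMr// lerBlDl lerDr exprn_ge0.
Unshelve. all: by end_near. Qed.

(** Induction along [seq_dist_rec]: each unfolding adds [r] and halves the rest, and [2 * r] is the
    fixed point of that recursion. *)
Lemma seq_dist_le_prefix m x y (r : R) : 0 <= r ->
  (forall n, (n < m)%N -> mdist (x n) (y n) <= r) ->
  sd x y <= 2 * r + 2 ^- m * (2 * D).
Proof.
move=> r0; elim: m x y => [|m IH] x y xyr.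
  rewrite expr0 invr1 mul1r (@le_trans _ _ (2 * D))// ?seq_dist_le//.
  by rewrite lerDr mulr_ge0.
rewrite seq_dist_rec.
have := xyr 0%N isT.
have := IH (T x) (T y) (fun n nm => xyr n.+1 nm).
rewrite exprS invfM; set s := sd _ _; set q := 2 ^- m.
lra.
Qed.

End seqdist.

(** * Packing and covering in Ahlfors regular spaces *)

Lemma powR_divl (R : realType) (x y s : R) : 0 <= x -> 0 < y ->
  (x / y) `^ s = x `^ s / y `^ s.
Proof.
move=> x0 y0; have y0' := ltW y0.
rewrite -[X in X `^ s / _](divfK (lt0r_neq0 y0) x) [(x / y * y) `^ s]powRM//.
  by rewrite mulfK// lt0r_neq0// powR_gt0.
by rewrite divr_ge0.
Qed.

Section packing.
Context {R : realType} {X : pointedMetricType R}.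
Implicit Types (r t K : R) (l : seq X) (x y z : X).
Variables (rho : probability (g_sigma_algebraType (@open X)) R) (s c r0 : R).
Hypothesis c1 : 1 <= c.
Hypothesis reg : forall (x : X) (r : R), 0 < r -> r <= r0 ->
  ((c^-1 * r `^ s)%:E <= rho (metric_closed_ball mdist x r)
        <= (c * r `^ s)%:E)%E.
Local Notation B := (metric_closed_ball (@mdist R X)).

Definition separated (r : R) (l : seq X) := pairwise (fun x y => r < mdist x y) l.

Lemma separated_cons r x l : separated r (x :: l) =
  all (fun y => r < mdist x y) l && separated r l.
Proof. by []. Qed.

Let c0 : 0 < c. Proof. exact: lt_le_trans c1. Qed.

Let mB x r : measurable (B x r : set (g_sigma_algebraType (@open X))).
Proof.
rewrite -[B x r]setCK; apply: measurableC; apply: sub_sigma_algebra.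
rewrite /= openE => y /= /negP; rewrite -ltNge => xy.
apply/nbhs_ballP; exists (mdist x y - r) => /=; first by rewrite subr_gt0.
move=> z; rewrite ballEmdist/= => yz /=; apply/negP; rewrite -ltNge.
have := metric_triangle x z y; rewrite (metric_sym z); lra.
Qed.

Let U r l := \big[setU/set0]_(y <- l) B y r.

Let mU r l : measurable (U r l : set (g_sigma_algebraType (@open X))).
Proof. by rewrite /U; apply: bigsetU_measurable. Qed.

Let inU r l z : U r l z -> exists2 y, y \in l & mdist y z <= r.
Proof.
rewrite /U -bigcup_seq => -[y /= yl yz].
by exists y.
Qed.

Let rhoU r l : separated (2 * r) l -> rho (U r l) = (\sum_(y <- l) rho (B y r))%E.
Proof.
elim: l => [|x l IH]; first by rewrite /U !big_nil measure0.
rewrite separated_cons => /andP[/allP xl /IH IHl].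
rewrite big_cons -IHl -measureU//; first by rewrite /U big_cons.
apply/seteqP; split => // z -[xz /inU[y yl yz]].
have {}xz : mdist x z <= r := xz.
have := xl _ yl; have := metric_triangle x z y.
by rewrite (metric_sym z y); lra.
Qed.

Let rho_ge r l : 0 < r -> r <= r0 -> separated (2 * r) l ->
  (((size l)%:R * (c^-1 * r `^ s))%:E <= rho (U r l))%E.
Proof.
move=> rp rr0 /rhoU ->.
elim: l => [|x l IH]; first by rewrite big_nil mul0r.
rewrite big_cons /= -natr1 mulrDl mul1r addrC EFinD leeD//.
by have /andP[] := reg x rp rr0.
Qed.

(** The balls of radius [r / 2] around the points are disjoint and lie in the ball of radius
    [t + r / 2] around [x]; compare masses. *)
Lemma separated_size_ball r l x t : 0 < r -> 0 <= t -> t + r / 2 <= r0 ->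
  separated r l -> {in l, forall y, mdist x y <= t} ->
  (size l)%:R * (c^-1 * (r / 2) `^ s) <= c * (t + r / 2) `^ s.
Proof.
move=> rp tp tr sl lx.
have r20 : 0 < r / 2 by rewrite divr_gt0.
have rE : r = 2 * (r / 2) by field.
rewrite rE in sl; set q := r / 2 in r20 sl tr *.
have qr0 : q <= r0 by lra.
have tq : 0 < t + q by rewrite ltr_wpDl.
rewrite -lee_fin (le_trans (rho_ge r20 qr0 sl))//.
have /andP[_ le2] := reg x tq tr.
apply: (le_trans _ le2); apply: le_measure; rewrite ?inE//.
move=> z /inU[y yl yz]; rewrite /metric_closed_ball/=.
have := metric_triangle x y z; have := lx _ yl; lra.
Qed.

Lemma separated_size r l : 0 < r -> r <= r0 -> separated r l ->
  (size l)%:R * (c^-1 * (r / 2) `^ s) <= 1.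
Proof.
move=> rp rr0 sl.
have r20 : 0 < r / 2 by rewrite divr_gt0.
have rE : r = 2 * (r / 2) by field.
rewrite rE in sl; set q := r / 2 in r20 sl rE *.
have qr0 : q <= r0 by lra.
by rewrite -lee_fin (le_trans (rho_ge r20 qr0 sl))// probability_le1.
Qed.

Lemma cover_size_ball r l x t : 0 < r -> r <= r0 -> 0 < t -> t <= r0 ->
  (forall z, mdist x z <= t -> exists2 y, y \in l & mdist y z <= r) ->
  c^-1 * t `^ s <= (size l)%:R * (c * r `^ s).
Proof.
move=> rp rr0 tp tr0 H.
have /andP[le1 _] := reg x tp tr0.
rewrite -lee_fin (le_trans le1)//.
apply: (@le_trans _ _ (rho (U r l))).
  apply: le_measure; rewrite ?inE// => z /H[y yl yz].
  by rewrite /U -bigcup_seq; exists y.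
elim: l {H le1} => [|y l IH]; first by rewrite /U big_nil measure0 mul0r.
rewrite /U big_cons (le_trans (measureU2 _ _ _))//; first exact: mU.
rewrite /= -natr1 mulrDl mul1r addrC EFinD leeD//.
by have /andP[] := reg y rp rr0.
Qed.

(** By [separated_size] the lengths of separated lists are bounded, so a longest one exists. A point
    farther than [r] from all its members could be added to it. *)
Lemma maximal_separated r (P : X -> Prop) : 0 < r -> r <= r0 ->
  exists l, [/\ separated r l, {in l, forall y, P y} &
    forall z, P z -> exists2 y, y \in l & mdist y z <= r].
Proof.
move=> rp rr0.
pose Q n := `[< exists l, [/\ size l = n, separated r l & {in l, forall y, P y}] >].
have Q0 : exists n, Q n by exists 0%N; apply/asboolP; exists [::].
have cr : 0 < c^-1 * (r / 2) `^ s by rewrite mulr_gt0 ?invr_gt0 ?powR_gt0 ?divr_gt0.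
have Qb n : Q n -> (n <= Num.bound (c^-1 * (r / 2) `^ s)^-1)%N.
  move=> /asboolP[l [<- sl _]].
  have := separated_size rp rr0 sl.
  rewrite -ler_pdivlMr// mul1r => /le_lt_trans /(_ (archi_boundP _)).
  by rewrite invr_ge0 ltW// => /(_ isT); rewrite ltr_nat => /ltnW.
have [n /asboolP[l [ln sl lP]] nmax] := ex_maxnP Q0 Qb.
exists l; split => // z Pz; apply: contrapT => /forall2NP H.
suff : (n.+1 <= n)%N by rewrite ltnn.
apply: nmax; apply/asboolP; exists (z :: l); split => //=.
- by rewrite ln.
- rewrite /separated/= -/(separated r l) sl andbT; apply/allP => y yl.
  by have [//|/negP] := H y; rewrite -ltNge metric_sym.
- by move=> y; rewrite inE => /predU1P[->//|/lP].
Qed.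

Lemma covering_net r : 0 < r -> r <= r0 -> exists l : seq X,
  [/\ separated r l, forall z, exists2 y, y \in l & mdist y z <= r &
      (size l)%:R <= c * 2 `^ s * r `^ (- s)].
Proof.
move=> rp rr0; have [l [sl _ lz]] := @maximal_separated r xpredT rp rr0.
exists l; split => // [z|]; first exact: lz.
have := separated_size rp rr0 sl.
have p2 : 0 < (2 : R) `^ s by rewrite powR_gt0.
have pr : 0 < r `^ s by rewrite powR_gt0.
rewrite (powR_divl s (ltW rp))// -ler_pdivlMr; last first.
  by rewrite !mulr_gt0 ?invr_gt0.
move=> /le_trans -> //.
by rewrite powRN le_eqVlt; apply/orP; left; apply/eqP; field; rewrite !gt_eqF.
Qed.

(** The bound is free of [r]. It keeps the number of plausible guesses in the Fano-type argument
    constant as the scale shrinks. *)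
Lemma separated_local_count r l x K : 0 < r -> 0 <= K -> (K + 1) * r <= r0 ->
  separated r l ->
  (count (fun y => mdist x y <= K * r) l)%:R <= c ^+ 2 * (2 * K + 1) `^ s.
Proof.
move=> rp K0 Kr sl; rewrite -size_filter.
set l' := [seq y <- l | _].
have sl' : separated r l' by apply: subseq_pairwise sl; exact: filter_subseq.
have := @separated_size_ball r l' x (K * r) rp.
have Kr' : K * r + r / 2 <= r0 by lra.
move=> /(_ (mulr_ge0 K0 (ltW rp)) Kr' sl').
have l'x : {in l', forall y, mdist x y <= K * r}.
  by move=> y; rewrite mem_filter => /andP[].
move=> /(_ l'x).
have -> : K * r + r / 2 = (2 * K + 1) * (r / 2) by field.
have K1 : 0 <= 2 * K + 1 by lra.
have r20 : 0 <= r / 2 by rewrite ltW// divr_gt0.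
rewrite (powRM s K1 r20).
set p := (r / 2) `^ s; have p0 : 0 < p by apply: powR_gt0; rewrite divr_gt0.
move=> h; rewrite expr2 -mulrA -ler_pdivrMl//.
rewrite -(ler_pM2r p0) -[leRHS]mulrA (le_trans _ h)//.
by rewrite le_eqVlt; apply/orP; left; apply/eqP; ring.
Qed.

(** A maximal separated list in the ball also covers it at radius [r], so the covering bound forces
    it to be long. *)
Lemma many_separated x t r : 0 < t -> t <= r0 -> 0 < r -> r <= r0 ->
  exists l : seq X, [/\ separated r l, {in l, forall y, mdist x y <= t} &
      c ^- 2 * (t / r) `^ s <= (size l)%:R].
Proof.
move=> tp tr0 rp rr0.
have [l [sl lx lz]] := @maximal_separated r (fun y => mdist x y <= t) rp rr0.
exists l; split => //.
have := cover_size_ball rp rr0 tp tr0 lz.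
rewrite mulrA -ler_pdivrMr; last by rewrite powR_gt0.
rewrite -ler_pdivrMr// => /(le_trans _) -> //.
rewrite (powR_divl s (ltW tp))// expr2 invfM.
by rewrite le_eqVlt; apply/orP; left; apply/eqP; ring.
Qed.

End packing.

(** * Mutual information and finite partitions *)

Section information.
Context {R : realType}.

Lemma ln_le_subr1 (x : R) : 0 < x -> ln x <= x - 1.
Proof.
by move=> x0; rewrite -{1}[x](subrKC 1) le_ln1Dx//; lra.
Qed.

(** Gibbs' inequality against mass [K^-1] at each point of the support, with [ln x <= x - 1] at
    [x = K^-1 / q j]. *)
Lemma entropy_le_ln (J : finType) (q : J -> R) (K : nat) : (0 < K)%N ->
  (forall j, 0 <= q j) -> \sum_j q j = 1 -> (#|[pred j | (q j != 0)%R]| <= K)%N ->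
  \sum_j q j * - ln (q j) <= ln K%:R.
Proof.
move=> K0 q0 q1 cK.
have K0' : (0 : R) < K%:R by rewrite ltr0n.
rewrite -subr_ge0 -[ln _]mul1r -[X in X * ln _]q1 mulr_suml -sumrB.
rewrite (bigID [pred j | q j != 0])/= [X in _ + X]big1 ?addr0; last first.
  by move=> j /negPn/eqP ->; rewrite !mul0r subrr.
apply: (@le_trans _ _ (\sum_(j | q j != 0) (q j - K%:R^-1))).
  rewrite sumrB sumr_const.
  have -> : \sum_(j | q j != 0) q j = 1.
    by rewrite -q1 [RHS](bigID [pred j | q j != 0])/= [X in _ = _ + X]big1 ?addr0// => j /negPn/eqP.
  rewrite subr_ge0 -[_ *+ _]mulr_natr mulrC ler_pdivrMr// mul1r ler_nat.
  exact: cK.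
apply: ler_sum => j qj; have qj0 : 0 < q j by rewrite lt_neqAle eq_sym qj q0.
have := @ln_le_subr1 (K%:R^-1 / q j) (divr_gt0 _ qj0).
rewrite invr_gt0 => /(_ K0').
rewrite ln_div ?posrE ?invr_gt0// lnV ?posrE// => h.
have := ler_wpM2l (q0 j) h.
have -> : q j * (K%:R^-1 / q j - 1) = K%:R^-1 - q j by field; rewrite qj gt_eqF.
by rewrite !mulrBr mulrN; lra.
Qed.

(** Mutual information is at most the entropy of the second variable: [p i j <= pI i] bounds each
    logarithm by [- ln (q j)]. *)
Lemma mutual_information_sum_le (I J : finType) (p : I -> J -> R)
    (pI : I -> R) (q : J -> R) (K : nat) : (0 < K)%N ->
  (forall i j, 0 <= p i j) -> (forall i j, p i j <= pI i) ->
  (forall j, q j = \sum_i p i j) -> \sum_j q j = 1 ->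
  (#|[pred j | (q j != 0)%R]| <= K)%N ->
  \sum_i \sum_j p i j * ln (p i j / (pI i * q j)) <= ln K%:R.
Proof.
move=> K0 p0 ppI qE q1 cK.
have q0 j : 0 <= q j by rewrite qE sumr_ge0.
apply: le_trans (entropy_le_ln K0 q0 q1 cK).
rewrite exchange_big; apply: ler_sum => j _ /=.
rewrite {2}qE mulr_suml; apply: ler_sum => i _.
have [->|pij] := eqVneq (p i j) 0; first by rewrite !mul0r.
have pij0 : 0 < p i j by rewrite lt_neqAle eq_sym pij p0.
have pI0 : 0 < pI i by apply: lt_le_trans (ppI i j).
have qj0 : 0 < q j.
  by rewrite (lt_le_trans pij0)// qE (bigD1 i)//= lerDl sumr_ge0.
rewrite ler_wpM2l// -lnV ?posrE// ler_ln ?posrE ?invr_gt0 ?divr_gt0 ?mulr_gt0//.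
by rewrite invfM mulrA ler_piMl ?invr_ge0 ?(ltW qj0)// ler_pdivrMr// mul1r.
Qed.

(* Gibbs' inequality against the conditional law [exp (h i j)]. *)
Lemma mutual_information_sum_ge (I J : finType) (p : I -> J -> R)
    (pI : I -> R) (q : J -> R) (h : I -> J -> R) (E : R) :
  (forall i j, 0 <= p i j) ->
  (forall i, pI i = \sum_j p i j) -> (forall j, q j = \sum_i p i j) ->
  \sum_j q j = 1 ->
  (forall i, pI i <= expR (- E)) -> (forall j, \sum_i expR (h i j) <= 1) ->
  E + \sum_i \sum_j p i j * h i j <=
    \sum_i \sum_j p i j * ln (p i j / (pI i * q j)).
Proof.
move=> p0 pIE qE q1 pE hj.
have sp : \sum_i \sum_j p i j = 1.
  by rewrite exchange_big -[RHS]q1; apply: eq_bigr => j _; rewrite qE.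
(* This is [ln x <= x - 1] at [x = q j * expR (h i j) / p i j]. Summed over [i] and [j], the
   corrections [p i j - q j * expR (h i j)] have a nonnegative total, because the guesses have mass
   at most 1 for every [j]. *)
have term i j : p i j * (E + h i j) + (p i j - q j * expR (h i j)) <=
    p i j * ln (p i j / (pI i * q j)).
  have qj0 : 0 <= q j by rewrite qE sumr_ge0.
  have [->|pij] := eqVneq (p i j) 0.
    by rewrite !mul0r add0r sub0r oppr_le0 mulr_ge0 ?expR_ge0.
  have pij0 : 0 < p i j by rewrite lt_neqAle eq_sym pij p0.
  have pI0 : 0 < pI i.
    by rewrite (lt_le_trans pij0)// pIE (bigD1 j)//= lerDl sumr_ge0.
  have {}qj0 : 0 < q j.
    by rewrite (lt_le_trans pij0)// qE (bigD1 i)//= lerDl sumr_ge0.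
  have e0 := expR_gt0 (h i j).
  rewrite ln_div ?posrE ?mulr_gt0// lnM ?posrE//.
  have lpI : ln (pI i) <= - E by rewrite -[leRHS]expRK ler_ln ?posrE ?expR_gt0.
  have := @ln_le_subr1 (q j * expR (h i j) / p i j).
  rewrite divr_gt0 ?mulr_gt0// => /(_ isT).
  rewrite ln_div ?posrE ?mulr_gt0// lnM ?posrE// expRK => /(ler_wpM2l (p0 i j)).
  rewrite (_ : p i j * (q j * expR (h i j) / p i j - 1) =
    q j * expR (h i j) - p i j); last by field; rewrite pij.
  have := ler_wpM2l (p0 i j) lpI.
  rewrite !mulrBr !mulrDr mulrN; lra.
apply: (@le_trans _ _ (\sum_i \sum_j (p i j * (E + h i j) +
  (p i j - q j * expR (h i j))))); last first.
  by apply: ler_sum => i _; apply: ler_sum => j _; exact: term.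
under [leRHS]eq_bigr do rewrite big_split/= sumrB.
rewrite big_split/= sumrB sp.
under [in leRHS]eq_bigr do under eq_bigr do rewrite mulrDr.
under [in leRHS]eq_bigr do rewrite big_split/= -mulr_suml.
rewrite big_split/= -mulr_suml sp mul1r lerDl subr_ge0.
rewrite exchange_big -q1; apply: ler_sum => j _ /=.
rewrite -mulr_sumr ler_piMr// qE sumr_ge0//.
Qed.

End information.

(** The integral of a nonnegative function is a supremum over the simple functions below it, hence
    monotone for arbitrary functions. The distortion is estimated this way, as its measurability is
    never established. *)
Lemma ge0_integral_le_nonmeasurable d (T : measurableType d) (R : realType)
    (mu : {measure set T -> \bar R}) (f g : T -> \bar R) :
  (forall x, 0 <= f x)%E -> (forall x, f x <= g x)%E ->
  (\int[mu]_x f x <= \int[mu]_x g x)%E.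
Proof.
move=> f0 fg; have g0 x : (0 <= g x)%E by exact: le_trans (fg x).
rewrite !ge0_integralTE//; apply: le_ereal_sup => _ [h /= hf <-].
by exists h => // x; exact: le_trans (fg x).
Qed.

Section finite_valued.
Context d (T : measurableType d) (R : realType) (P : probability T R).

Lemma probability_sum_partition (I : finType) (F : I -> set T) (S : set T) :
  measurable S -> (forall i, measurable (F i)) -> trivIset setT F ->
  S `<=` \bigcup_i F i -> fine (P S) = \sum_i fine (P (S `&` F i)).
Proof.
move=> mS mF tF SF.
have mSF i : measurable (S `&` F i) by exact: measurableI.
rewrite sum_fine/=; last by move=> i _; rewrite fin_num_measure.
congr fine; rewrite (fsbig_seq _ _ (index_enum_uniq I)) -measure_fin_bigcup//.
- congr (P _); rewrite -setI_bigcupr; apply/seteqP; split=> [x Sx|x []//].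
  by split => //; have [i _ Fx] := SF _ Sx; exists i => //=; rewrite mem_index_enum.
- by move=> i j _ _ [w [[_ Fi] [_ Fj]]]; apply: tF => //; exists w.
Qed.

(** A cell of the second partition with positive probability contains some [y b], and different
    cells contain different ones. So at most [#|B|] cells carry mass, whatever the partition. *)
Lemma mutual_information_le d1 d2 (T1 : measurableType d1)
    (T2 : measurableType d2) (X : T -> T1) (Y : T -> T2) (B : finType)
    (y : B -> T2) :
  measurable_fun setT X -> measurable_fun setT Y ->
  (forall w, exists b, Y w = y b) ->
  (mutual_information P X Y <= (ln #|B|%:R)%:E)%E.
Proof.
move=> mX mY Yy; apply: ge_ereal_sup => _ [a [b [p [q [[pp mp] [pq mq] ->]]]]].
rewrite lee_fin.
have [Up tp _] := pp; have [Uq tq _] := pq.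
rewrite /cover in Up Uq.
have mXp i : measurable (X @^-1` p i) by rewrite -[X in measurable X]setTI; apply: mX.
have mYq j : measurable (Y @^-1` q j) by rewrite -[X in measurable X]setTI; apply: mY.
have [b0 _] := Yy point.
have B0 : (0 < #|B|)%N by apply/card_gt0P; exists b0.
apply: mutual_information_sum_le => //.
- move=> i j; apply: fine_ge0; exact: measure_ge0.
- move=> i j; have mI : measurable (X @^-1` p i `&` Y @^-1` q j).
    exact: measurableI.
  by apply: fine_le; rewrite ?fin_num_measure//; apply: le_measure; rewrite ?inE.
- move=> j; rewrite (probability_sum_partition (F := fun i => X @^-1` p i))//.
  + by apply: eq_bigr => i _; rewrite setIC.
  + by move=> i k _ _ [w [pi pk]]; apply: tp => //; exists (X w).
  + by rewrite -preimage_bigcup Up preimage_setT.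
- rewrite -[RHS](_ : fine (P setT) = 1); last by rewrite probability_setT.
  rewrite (probability_sum_partition (F := fun j => Y @^-1` q j))//.
  + by apply: eq_bigr => j _; rewrite setTI.
  + by move=> i k _ _ [w [pi pk]]; apply: tq => //; exists (Y w).
  + by rewrite -preimage_bigcup Uq preimage_setT.
- pose f j := odflt b0 [pick c | `[< q j (y c) >]].
  have fq j : fine (P (Y @^-1` q j)) != 0 -> q j (y (f j)).
    move=> qj; have [w qw] : Y @^-1` q j !=set0.
      by apply/set0P; apply: contra qj => /eqP ->; rewrite measure0.
    rewrite /f; case: pickP => [c /asboolP//|no].
    by have [c Yc] := Yy w; have := no c; rewrite asboolT// -Yc.
  rewrite -(@card_in_imset _ _ f) ?max_card// => i j; rewrite !inE => /fq qi /fq qj fij.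
  by apply: tq => //; exists (y (f i)); split => //; rewrite fij.
Qed.

(** Evaluate the supremum at the partitions into fibres of [F] and [G] and apply the finite
    inequality. *)
Lemma mutual_information_ge d1 d2 (T1 : measurableType d1)
    (T2 : measurableType d2) (X : T -> T1) (Y : T -> T2) (A B : finType)
    (F : T1 -> A) (G : T2 -> B) (h : A -> B -> R) (E : R) :
  measurable_fun setT X -> measurable_fun setT Y ->
  (forall a, measurable (F @^-1` [set a])) ->
  (forall b, measurable (G @^-1` [set b])) ->
  (forall a, fine (P (X @^-1` (F @^-1` [set a]))) <= expR (- E)) ->
  (forall b, \sum_a expR (h a b) <= 1) ->
  ((E + \sum_a \sum_b
     fine (P ((F \o X) @^-1` [set a] `&` (G \o Y) @^-1` [set b])) * h a b)%:E
   <= mutual_information P X Y)%E.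
Proof.
move=> mX mY mF mG pE hh.

(* [partition] requires nonempty members, so only values whose fibre is nonempty may index it; the
   other values contribute zero to the full double sum. *)
pose A' := [pred a | `[< F @^-1` [set a] !=set0 >]].
pose B' := [pred b | `[< G @^-1` [set b] !=set0 >]].
have mXF a : measurable ((F \o X) @^-1` [set a]).
  rewrite comp_preimage -[X in measurable X]setTI; exact: mX.
have mYG b : measurable ((G \o Y) @^-1` [set b]).
  rewrite comp_preimage -[X in measurable X]setTI; exact: mY.
have part U (C : finType) (f : U -> C) : partition setT
   (fun i : 'I_#|[pred a | `[< f @^-1` [set a] !=set0 >]]| => f @^-1` [set enum_val i]) setT.
  split.
  - apply/seteqP; split => // u _.
    have fu : f u \in [pred a | `[< f @^-1` [set a] !=set0 >]].
      by apply/asboolP; exists u.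
    by exists (enum_rank_in fu (f u)) => //=; rewrite enum_rankK_in.
  - by move=> i j _ _ [u [/= ui uj]]; apply: enum_val_inj; rewrite -ui -uj.
  - by move=> i _; have /asboolP := enum_valP i.
apply: (le_trans _ (ereal_sup_ubound _)); last first.
  exists #|A'|, #|B'|, (fun i => F @^-1` [set enum_val i]), (fun j => G @^-1` [set enum_val j]).
  by split; first split; [exact: part|move=> i; exact: mF|
     split; [exact: part|move=> i; exact: mG]|].
rewrite lee_fin.
pose p a b := fine (P ((F \o X) @^-1` [set a] `&` (G \o Y) @^-1` [set b])).
pose pA a := fine (P ((F \o X) @^-1` [set a])).
pose pB b := fine (P ((G \o Y) @^-1` [set b])).
have pE0 a b : ~~ ((a \in A') && (b \in B')) -> p a b = 0.
  rewrite negb_and !inE => /orP[]/asboolPn no; rewrite /p (_ : _ `&` _ = set0) ?measure0//;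
    rewrite -subset0 => w [/= Fw Gw]; apply: no; [by exists (X w)|by exists (Y w)].
rewrite (eq_bigr (fun i => \sum_(b in B') p (enum_val i) b *
    ln (p (enum_val i) b / (pA (enum_val i) * pB b)))); last first.
  move=> i _; rewrite [RHS](big_enum_val (fun b => p (enum_val i) b *
    ln (p (enum_val i) b / (pA (enum_val i) * pB b)))).
  by apply: eq_bigr.
rewrite -(big_enum_val (fun a => \sum_(b in B') p a b * ln (p a b / (pA a * pB b)))).
rewrite [leRHS](_ : _ = \sum_a \sum_b p a b * ln (p a b / (pA a * pB b))); last first.
  rewrite big_mkcond/=; apply: eq_bigr => a _; rewrite big_mkcond/=; case: ifPn => aA.
    by apply: eq_bigr => b _; case: ifPn => // bB; rewrite pE0 ?mul0r// (negbTE bB) andbF.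
  by rewrite big1// => b _; rewrite pE0 ?mul0r// (negbTE aA).
apply: mutual_information_sum_ge => //.
- by move=> a b; apply: fine_ge0; exact: measure_ge0.
- move=> a; rewrite /pA (probability_sum_partition (F := fun b => (G \o Y) @^-1` [set b]))//.
  + by move=> i k _ _ [w [/= <- <-]].
  + by move=> w _; exists (G (Y w)).
- move=> b; rewrite /pB (probability_sum_partition (F := fun a => (F \o X) @^-1` [set a]))//.
  + by apply: eq_bigr => i _; rewrite setIC.
  + by move=> i k _ _ [w [/= <- <-]].
  + by move=> w _; exists (F (X w)).
- rewrite -[RHS](_ : fine (P setT) = 1); last by rewrite probability_setT.
  rewrite (probability_sum_partition (F := fun b => (G \o Y) @^-1` [set b]))//.
  + by apply: eq_bigr => j _; rewrite setTI.
  + by move=> i k _ _ [w [/= <- <-]].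
  + by move=> w _; exists (G (Y w)).
Qed.

Lemma integral_finite_valued (A : finType) (f : T -> A) (h : A -> R) :
  (forall a, measurable (f @^-1` [set a])) -> (forall a, 0 <= h a) ->
  (\int[P]_w (h (f w))%:E)%E = (\sum_a h a * fine (P (f @^-1` [set a])))%:E.
Proof.
move=> mf h0.
rewrite (eq_integral (fun w => (\sum_a (h a)%:E * (\1_(f @^-1` [set a]) w)%:E)%E)); last first.
  move=> w _; rewrite (bigD1 (f w))//= big1 ?adde0; last first.
    move=> a af; rewrite indicE memNset ?mule0//= => fa; move: af.
    by rewrite -fa eqxx.
  by rewrite indicE mem_set// mule1.
rewrite ge0_integral_sum//; last 2 first.
  - move=> a; apply: measurable_funeM; apply/measurable_EFinP.
    exact: measurable_indic.
  - by move=> a w _; rewrite mule_ge0// lee_fin.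
rewrite -sumEFin; apply: eq_bigr => a _.
rewrite ge0_integralZl//; last 2 first.
  - by apply/measurable_EFinP; exact: measurable_indic.
  - by rewrite lee_fin.
rewrite integral_indic// setIT EFinM fineK// fin_num_measure//.
Qed.

End finite_valued.

(** * Birkhoff sums and weighted covers *)

Section birkhoff.
Context {R : realType} {Y : pointedType}.
Variables (T : Y -> Y) (phi : Y -> R) (M : R).
Hypothesis phiM : forall x, `|phi x| <= M.
Local Notation S := (birkhoff_sum T phi).

Lemma birkhoff_sumD m n x : S (m + n) x = S m x + S n (iter m T x).
Proof.
rewrite /birkhoff_sum big_split_ord/=; congr (_ + _).
by apply: eq_bigr => i _; rewrite addnC iterD.
Qed.

Lemma birkhoff_sum_norm N x : `|S N x| <= N%:R * M.
Proof.
rewrite (le_trans (ler_norm_sum _ _ _))// (le_trans (ler_sum _ (fun i _ => phiM _)))//.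
by rewrite sumr_const card_ord mulr_natl.
Qed.

Lemma has_sup_birkhoff (A : set Y) N : A !=set0 -> has_sup [set S N x | x in A].
Proof.
move=> [x Ax]; split; first by exists (S N x), x.
exists (N%:R * M) => _ [y _ <-].
by rewrite (le_trans (ler_norm _))// birkhoff_sum_norm.
Qed.

Lemma birkhoff_le_sup (A : set Y) N x : A x -> S N x <= sup [set S N x | x in A].
Proof.
move=> Ax; apply: ub_le_sup; last by exists x.
by case: (@has_sup_birkhoff A N _) => //; exists x.
Qed.

(** Fekete's lemma for [u N], the supremum of [S N]. Since [N * beta <= u N] at every [N], good
    starting points exist at every length. In the other direction only finitely many lengths exceed
    [N * (beta + eta)], and [C] pays for them. *)
Lemma max_ergodic_average : exists beta : R,
  [/\ forall N eta, 0 < eta -> exists x, N%:R * (beta - eta) <= S N x &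
      forall eta, 0 < eta -> exists C, forall N x, S N x <= N%:R * (beta + eta) + C].
Proof.
pose u N := sup [set S N x | x in setT].
have T0 : [set: Y] !=set0 by exists point.
have usub m n : u (m + n)%N <= u m + u n.
  apply: ge_sup; first by case: (has_sup_birkhoff (m + n) T0).
  by move=> _ [x _ <-]; rewrite birkhoff_sumD lerD// birkhoff_le_sup.
have ub n : n%:R * (- M) <= u n.
  apply: le_trans (birkhoff_le_sup n (I : setT point)).
  by have := birkhoff_sum_norm n point; rewrite ler_norml mulrN => /andP[].
have [beta ubeta betau] := fekete usub ub.
exists beta; split => [N eta eta0|eta eta0].
  case: N => [|N]; first by exists point; rewrite mul0r /birkhoff_sum big_ord0.
  have N0 : (0 : R) < N.+1%:R * eta by rewrite mulr_gt0.
  have [_ [x _ <-] xu] := sup_adherent N0 (has_sup_birkhoff N.+1 T0).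
  exists x; have := betau N.+1; rewrite mulrBr -/(u N.+1) in xu *.
  lra.
move/cvgrPdist_lt : ubeta => /(_ _ eta0)[N0 _ N0P].
exists (N0%:R * (M + `|beta + eta|)) => N x.
have [NN0|NN0] := leqP N0 N.
  apply: le_trans (birkhoff_le_sup N (I : setT x)) _.
  rewrite -/(u N) (@le_trans _ _ (N%:R * (beta + eta)))//; last first.
    rewrite lerDl mulr_ge0// addr_ge0//.
    by have := phiM x; apply: le_trans.
  case: N NN0 => [|N] NN0; first by rewrite mul0r /u; apply: ge_sup;
    [case: (has_sup_birkhoff 0 T0)|move=> _ [y _ <-]; rewrite /birkhoff_sum big_ord0].
  rewrite -ler_pdivrMl// -lerBlDl ltW// (le_lt_trans (ler_norm _))//.
  by rewrite distrC; exact: N0P.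
apply: le_trans (ler_norm _) _; apply: le_trans (birkhoff_sum_norm _ _) _.
have M0 : 0 <= M by apply: le_trans (phiM x).
have NN0' : (N%:R : R) <= N0%:R by rewrite ler_nat ltnW.
apply: (@le_trans _ _ (N0%:R * M)); first by rewrite ler_wpM2r.
rewrite mulrDr; have : - (N%:R * (beta + eta)) <= N0%:R * `|beta + eta|.
  rewrite -mulrN (@le_trans _ _ (N%:R * `|beta + eta|)) ?ler_wpM2r//.
  by rewrite ler_wpM2l// -normrN ler_norm.
lra.
Qed.

End birkhoff.

Section cover_number.
Context {R : realType} {Y : pointedType}.
Implicit Types (d : Y -> Y -> R) (phi : Y -> R).

(* Discarding the empty members removes their spurious weight [e `^ 0]. *)
Lemma weighted_cover_number_le d phi (e : R) (I : finType) (U : I -> set Y) :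
  \bigcup_i U i = setT -> (forall i, (diam d (U i) < e%:E)%E) ->
  (weighted_cover_number d phi e <=
    (\sum_(i | `[< U i !=set0 >]) e `^ (- sup [set phi x | x in U i]))%:E)%E.
Proof.
move=> UT Ud; apply: ereal_inf_lbound.
pose A := [pred i | `[< U i !=set0 >]].
exists #|A|, (fun k => U (enum_val k)); split.
- apply/seteqP; split => // x _.
  have [i _ Uix] : (\bigcup_i U i) x by rewrite UT.
  have iA : i \in A by apply/asboolP; exists x.
  by exists (enum_rank_in iA i) => //; rewrite enum_rankK_in.
- by move=> i; exact: Ud.
- congr (_%:E).
  by rewrite -(big_enum_val (fun i => e `^ (- sup [set phi x | x in U i]))).
Qed.

Lemma weighted_cover_number_ge0 d phi (e : R) :
  (0 <= weighted_cover_number d phi e)%E.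
Proof.
apply: le_ereal_inf_tmp => _ [n [U [_ _ ->]]].
by rewrite lee_fin sumr_ge0// => i _; exact: powR_ge0.
Qed.

Lemma dyn_dist_ge d T N x y n : (n < N)%N ->
  d (iter n T x) (iter n T y) <= dyn_dist d T N x y.
Proof.
move=> nN; exact: (le_bigmax 0 (fun n : 'I_N => d (iter n T x) (iter n T y))
  (Ordinal nN)).
Qed.

Lemma dyn_dist_le d T N x y (r : R) : 0 <= r ->
  (forall n, (n < N)%N -> d (iter n T x) (iter n T y) <= r) ->
  dyn_dist d T N x y <= r.
Proof. by move=> r0 H; apply/bigmax_leP; split => // i _; exact: H. Qed.

Lemma dyn_dist_ge0 d T N x y : 0 <= dyn_dist d T N x y.
Proof. exact: bigmax_ge_id. Qed.

Lemma dyn_distD_le d T m n x y : dyn_dist d T (m + n) x y <=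
  Num.max (dyn_dist d T m x y) (dyn_dist d T n (iter m T x) (iter m T y)).
Proof.
apply: dyn_dist_le => [|k kmn]; first by rewrite le_max dyn_dist_ge0.
rewrite le_max; have [km|mk] := ltnP k m; first by rewrite dyn_dist_ge.
rewrite -(subnK mk) !iterD dyn_dist_ge ?orbT//.
by rewrite ltn_subLR.
Qed.

Lemma diam_lt d (U : set Y) (r e : R) : r < e ->
  (forall x y, U x -> U y -> d x y <= r) -> (diam d U < e%:E)%E.
Proof.
move=> re H; apply: le_lt_trans (_ : r%:E < e%:E)%E; last by rewrite lte_fin.
by apply: ge_ereal_sup => _ [[x y] /= [Ux Uy] <-]; rewrite lee_fin H.
Qed.

Lemma lt_diam d (U : set Y) (e : R) x y : (diam d U < e%:E)%E ->
  U x -> U y -> d x y < e.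
Proof.
move=> dU Ux Uy; rewrite -lte_fin; apply: le_lt_trans dU.
by apply: ereal_sup_ubound; exists (x, y).
Qed.

Section entropy.
Variables (d : Y -> Y -> R) (T : Y -> Y) (phi : Y -> R) (M e : R).
Hypothesis phiM : forall x, `|phi x| <= M.
Hypothesis e01 : 0 < e < 1.
Local Notation W N := (weighted_cover_number (dyn_dist d T N) (birkhoff_sum T phi N) e).

Let powR_antitone (x y : R) : x <= y -> e `^ (- y) >= e `^ (- x).
Proof.
move=> xy; have /andP[e0 e1] := e01.
by rewrite /powR gt_eqF// ler_expR !mulNr lerN2 ler_wnM2r// ln_le0// ltW.
Qed.

(** The sets [U i] intersected with preimages of [V j] cover at length [m + n], and by the cocycle
    identity their weights are at most the products. Empty intersections must be discarded: their
    weight [e ^ 0] could exceed the product. *)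
Lemma cover_productD (m n a b : nat) (U : 'I_a -> set Y) (V : 'I_b -> set Y) :
  \bigcup_i U i = setT -> \bigcup_i V i = setT ->
  (forall i, diam (dyn_dist d T m) (U i) < e%:E)%E ->
  (forall i, diam (dyn_dist d T n) (V i) < e%:E)%E ->
  (W (m + n) <= ((\sum_(i < a) e `^ (- sup [set birkhoff_sum T phi m x | x in U i])) *
    (\sum_(i < b) e `^ (- sup [set birkhoff_sum T phi n x | x in V i])))%:E)%E.
Proof.
move=> UT VT Ud Vd.
pose I := ('I_a * 'I_b)%type.
pose Q (i : I) := U i.1 `&` iter m T @^-1` V i.2.
apply: le_trans (@weighted_cover_number_le _ _ e I Q _ _) _.
- apply/seteqP; split => // x _.
  have [i _ Ui] : (\bigcup_i U i) x by rewrite UT.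
  have [j _ Vj] : (\bigcup_i V i) (iter m T x) by rewrite VT.
  by exists (i, j).
- move=> i; rewrite (@le_lt_trans _ _ (maxe (diam (dyn_dist d T m) (U i.1)) (diam (dyn_dist d T n) (V i.2))))//; last by rewrite gt_max Ud Vd.
  apply: ge_ereal_sup => _ [[x y] /= [[Ux Vx] [Uy Vy]] <-].
  apply: (@le_trans _ _ (Num.max (dyn_dist d T m x y) (dyn_dist d T n (iter m T x) (iter m T y)))%:E).
    by rewrite lee_fin dyn_distD_le.
  rewrite EFin_max ge_max; apply/andP; split; rewrite le_max; apply/orP.
    by left; apply: ereal_sup_ubound; exists (x, y).
  by right; apply: ereal_sup_ubound; exists (iter m T x, iter m T y).
- rewrite lee_fin mulr_suml; under [leRHS]eq_bigr do rewrite mulr_sumr.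
  rewrite pair_big/= big_mkcond; apply: ler_sum => -[i j] _ /=.
  case: ifPn => [/asboolP[x Qx]|_]; last by rewrite mulr_ge0 ?powR_ge0.
  rewrite -powRD; last by apply/implyP => _; rewrite gt_eqF//; case/andP: e01.
  rewrite -opprD; apply: powR_antitone.
  apply: ge_sup; first by exists (birkhoff_sum T phi (m + n) x), x.
  move=> _ [y [Uy Vy] <-]; rewrite birkhoff_sumD lerD//.
    exact: (birkhoff_le_sup T phiM).
  exact: (birkhoff_le_sup T phiM).
Qed.

(** The two bounds make the cover numbers finite and positive, so their logarithms form a
    subadditive sequence and the [limn] in [entropy_at_scale] is a true limit. The constant [c]
    disappears on division by [N]. *)
Lemma entropy_at_scale_bounds (a b c : R) :
  (forall N, (expR (N%:R * a))%:E <= W N <= (expR (N%:R * b + c))%:E)%E ->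
  (a%:E <= entropy_at_scale d T phi e <= b%:E)%E.
Proof.
move=> H.
have Wfin N : W N \is a fin_num.
  have /andP[h1 h2] := H N; rewrite ge0_fin_numE ?weighted_cover_number_ge0//.
  by rewrite (le_lt_trans h2)// ltry.
pose w N := fine (W N).
have WE N : W N = (w N)%:E by rewrite fineK.
have w_ge N : expR (N%:R * a) <= w N by rewrite -lee_fin -WE; case/andP: (H N).
have w_le N : w N <= expR (N%:R * b + c) by rewrite -lee_fin -WE; case/andP: (H N).
have w0 N : 0 < w N by apply: lt_le_trans (w_ge N); exact: expR_gt0.
have wD m n : w (m + n)%N <= w m * w n.
  rewrite -ler_pdivrMr// -lee_fin -(WE m); apply: le_ereal_inf_tmp => _ [k [U [UT Ud ->]]].
  rewrite lee_fin; set A := \sum_(i < k) _.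
  have A0 : 0 < A.
    apply: lt_le_trans (w0 m) _; rewrite -lee_fin -WE.
    by apply: ereal_inf_lbound; exists k, U.
  rewrite ler_pdivrMr// -ler_pdivrMl// -lee_fin -(WE n).
  apply: le_ereal_inf_tmp => _ [l [V [VT Vd ->]]].
  rewrite lee_fin ler_pdivrMl// -lee_fin -WE.
  exact: cover_productD.
pose u N := ln (w N).
have uD m n : u (m + n)%N <= u m + u n.
  by rewrite /u -lnM ?posrE// ler_ln ?posrE// mulr_gt0.
have u_ge N : N%:R * a <= u N by rewrite -[leLHS]expRK ler_ln ?posrE ?expR_gt0.
have u_le N : u N <= N%:R * b + c by rewrite -[leRHS]expRK ler_ln ?posrE ?expR_gt0.
have [l ul lu] := fekete uD u_ge.
have -> : entropy_at_scale d T phi e = l%:E.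
  rewrite /entropy_at_scale; apply/cvg_lim => //.
  rewrite (_ : (fun N => _) = EFin \o (fun N => N%:R^-1 * u N)).
    by apply: cvg_EFin => //; near=> N.
  by apply/funext => N; rewrite /= WE lne_EFin// EFinM.
rewrite !lee_fin; apply/andP; split.
  rewrite -(cvg_lim _ ul)//; apply: limr_ge; first by apply/cvg_ex; exists l.
  by exists 1%N => // N /= N0; rewrite ler_pdivlMl ?ltr0n.
apply/ler_addgt0Pr => eta eta0.
have [N _ NP] : \forall N \near \oo, `|c| / eta <= N%:R by exact: nbhs_infty_ger.
have := NP N.+1 (leqnSn N); rewrite ler_pdivrMr// => cN.
rewrite -(ler_pM2l (ltr0Sn R N)); apply: le_trans (lu _) _.
apply: le_trans (u_le _) _; rewrite mulrDr lerD2l.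
by apply: le_trans (ler_norm _) _.
Unshelve. all: by end_near. Qed.

End entropy.

End cover_number.

(** * Mean metric dimension of the shift *)

Section shift_cover.
Context {R : realType} {X : pointedMetricType R}.
Variables (D : R) (phi : (nat -> X) -> R) (M e : R).
Hypothesis mD : forall a b : X, mdist a b <= D.
Hypothesis phiM : forall x, `|phi x| <= M.
Hypothesis e01 : 0 < e < 1.
Local Notation T := (@left_shift R X).
Local Notation sd := (@seq_dist R X).
Local Notation S := (birkhoff_sum T phi).
Local Notation W N := (weighted_cover_number (dyn_dist sd T N) (S N) e).

Let e0 : 0 < e. Proof. by case/andP: e01. Qed.
Let e1 : e < 1. Proof. by case/andP: e01. Qed.
Let lne0 : 0 < - ln e. Proof. by rewrite oppr_gt0 ln_lt0. Qed.
Let D0 : 0 <= D. Proof. exact: le_trans (mdist_ge0 _ _) (mD point point). Qed.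

Let powRE t : e `^ (- t) = expR (t * - ln e).
Proof. by rewrite /powR gt_eqF// mulNr mulrN. Qed.

(** The last of the metrics in [d_N] still sees coordinates beyond [N], so cells are taken on
    [N + m] coordinates. As [m] depends on [e] alone, the extra ones enter only the constant. *)
Lemma shift_cover_le (l : seq X) (b C : R) :
  (forall z, exists2 y, y \in l & mdist y z <= e / 16) ->
  (forall N x, S N x <= N%:R * b + C) ->
  exists c, forall N,
    (W N <= (expR (N%:R * (ln (size l)%:R + b * - ln e) + c))%:E)%E.
Proof.
move=> lnet Sle; have [e0' D0'] := (e0, D0).
have k0 : (0 < size l)%N by have [y] := lnet point; case: l {lnet}.
have lk : 0 <= ln ((size l)%:R : R) by rewrite ln_ge0// ler1n.
have e40 : 0 < e / 4 by rewrite divr_gt0.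
have [m mP] := exists_geometric_le (2 * D) e40.
exists (m%:R * ln (size l)%:R + C * - ln e) => N.
pose I := {ffun 'I_(N + m) -> 'I_(size l)}.
(* Two points of a cell are [e / 8] apart in each of its coordinates; the geometric weights double
   this to [e / 4], and the tail adds at most [e / 4]. *)
pose U (v : I) := [set x : nat -> X | forall i : 'I_(N + m),
   mdist (nth point l (v i)) (x i) <= e / 16].
have UT : \bigcup_v U v = setT.
  apply/seteqP; split => // x _.
  have pk (i : 'I_(N + m)) : exists j : 'I_(size l), mdist (nth point l j) (x i) <= e / 16.
    have [y yl yx] := lnet (x i).
    by exists (Ordinal (eq_ind_r is_true yl (index_mem y l))); rewrite /= nth_index.
  by exists [ffun i => projT1 (cid (pk i))] => // i; rewrite ffunE; case: cid.
have Ud v : (diam (dyn_dist sd T N) (U v) < e%:E)%E.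
  apply: (@diam_lt _ _ _ _ (e / 2)); first lra.
  move=> x y Ux Uy; apply: dyn_dist_le => [|n nN]; first lra.
  apply: (@le_trans _ _ (2 * (e / 8) + 2 ^- m * (2 * D))); last lra.
  apply: seq_dist_le_prefix => //; first lra.
  move=> i im; rewrite !iter_shift.
  have inN : (i + n < N + m)%N by rewrite addnC -addSn leq_add// ltnW.
  have := Ux (Ordinal inN); have := Uy (Ordinal inN) => /=.
  have := metric_triangle (x (i + n)%N) (nth point l (v (Ordinal inN))) (y (i + n)%N).
  rewrite (metric_sym (x _) (nth _ _ _)); lra.
apply: le_trans (weighted_cover_number_le _ UT Ud) _.
rewrite lee_fin.
apply: (@le_trans _ _ (\sum_(v : I) expR ((N%:R * b + C) * - ln e))).
  rewrite [leRHS](bigID [pred v | `[< U v !=set0 >]])/= ler_wpDr ?sumr_ge0//.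
  apply: ler_sum => v /asboolP[x Ux]; rewrite powRE ler_expR ler_wpM2r ?(ltW lne0)//.
  apply: ge_sup; first by exists (S N x), x.
  by move=> _ [y _ <-]; exact: Sle.
rewrite sumr_const card_ffun !card_ord -[leLHS]mulr_natl natrX.
rewrite -[X in X ^+ _](lnK (x := (size l)%:R)) ?posrE ?ltr0n//.
rewrite -expRM_natl -expRD ler_expR natrD.
by rewrite le_eqVlt; apply/orP; left; apply/eqP; ring.
Qed.

Lemma shift_cover_ge (k : nat) (t b w : R) : (0 < k)%N -> 0 <= t ->
  (forall x : X, exists l : seq X, [/\ separated e l,
     {in l, forall y, mdist x y <= t} & (k <= size l)%N]) ->
  (forall N, exists x, N%:R * b <= S N x) ->
  (forall x y, (forall n, mdist (x n) (y n) <= t) -> `|phi x - phi y| <= w) ->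
  forall N, ((expR (N%:R * (ln k%:R + (b - w) * - ln e)))%:E <= W N)%E.
Proof.
move=> k0 t0 kP bP wP N.
have [x xb] := bP N.
apply: le_ereal_inf_tmp => _ [n [U [UT Ud ->]]]; rewrite lee_fin.
pose l y := projT1 (cid (kP y)).
have lP y : [/\ separated e (l y), {in l y, forall z, mdist y z <= t} & (k <= size (l y))%N].
  by rewrite /l; case: cid.
pose I := {ffun 'I_N -> 'I_k}.
(* From index [N] on, [z v] keeps [x i], so it is within [t] of [x] at every index, as the
   continuity hypothesis on [phi] demands. *)
pose z (v : I) i := if insub i is Some j then nth point (l (x i)) (v j) else x i.
have zx v i : mdist (x i) (z v i) <= t.
  rewrite /z; case: insubP => [j ij ji|_]; last by rewrite mdistxx.
  have [_ lt lk] := lP (x i); apply: lt; rewrite mem_nth//.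
  exact: leq_trans (ltn_ord _) lk.
have zv v v' : v != v' -> exists2 i, (i < N)%N & e < mdist (z v i) (z v' i).
  move=> vv'; have [i vi] : exists i, v i != v' i.
    apply/existsP; move: vv'; apply: contraNT; rewrite negb_exists => /forallP h.
    by apply/eqP/ffunP => i; apply/eqP; have := h i; rewrite negbK.
  have zi u : z u i = nth point (l (x i)) (u i).
    by rewrite /z; case: insubP => [j _ /val_inj ->|] //; rewrite ltn_ord.
  exists i; [exact: ltn_ord|rewrite !zi].
  have [/(pairwiseP point) sp _ lk] := lP (x i).
  have hv (u : I) : (u i : nat) \in gtn (size (l (x i))).
    by rewrite inE (leq_trans (ltn_ord _) lk).
  have [|] := ltnP (v i) (v' i); first by apply: sp.
  rewrite leq_eqVlt => /predU1P[/val_inj h|]; first by rewrite h eqxx in vi.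
  by move=> ?; rewrite metric_sym; apply: sp.
have pk v : exists i : 'I_n, U i (z v).
  have [i _ Ui] : (\bigcup_i U i) (z v) by rewrite UT.
  by exists i.
pose f v := projT1 (cid (pk v)).
have fU v : U (f v) (z v) by rewrite /f; case: cid.
have finj : injective f.
  move=> v v' fv; apply/eqP; apply: contraT => /zv[i iN /lt_geF <-].
  apply: le_trans (seq_dist_ge mD i _ _) _.
  apply: le_trans (@dyn_dist_ge _ _ sd T N _ _ _ iN) _.
  by apply: ltW; apply: (lt_diam (Ud (f v))) => //; rewrite fv.
apply: (@le_trans _ _ (\sum_(v : I) e `^ (- sup [set S N x | x in U (f v)]))).
  apply: (@le_trans _ _ (\sum_(v : I) expR (N%:R * (b - w) * - ln e))).
    rewrite sumr_const card_ffun !card_ord -[leRHS]mulr_natl natrX.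
    rewrite -[X in X ^+ _](lnK (x := k%:R)) ?posrE ?ltr0n//.
    rewrite -expRM_natl -expRD ler_expR.
    by rewrite le_eqVlt; apply/orP; left; apply/eqP; ring.
  apply: ler_sum => v _; rewrite powRE ler_expR ler_wpM2r ?(ltW lne0)//.
  apply: le_trans (birkhoff_le_sup T phiM N (fU v)).
  rewrite mulrBr lerBlDr; apply: le_trans xb _.
  have -> : N%:R * w = \sum_(i < N) w by rewrite sumr_const card_ord mulr_natl.
  rewrite -lerBlDl -sumrB; apply: ler_sum => i _; apply: le_trans (ler_norm _) _.
  by apply: wP => m; rewrite !iter_shift.
(* As [f] is injective, the sum runs over distinct members of the cover, and the remaining members
   have nonnegative weight. *)
rewrite -(@big_image _ _ _ _ _ f predT (fun i => e `^ (- sup [set S N x | x in U i])))/=.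
rewrite [leRHS](bigID [pred i | i \in codom f])/=.
apply: ler_wpDr; first by apply: sumr_ge0 => i _; exact: powR_ge0.
rewrite big_uniq/=; last by rewrite map_inj_uniq ?enum_uniq.
by rewrite le_eqVlt; apply/orP; left; apply/eqP; apply: eq_bigl.
Qed.

End shift_cover.

(** The minimality clause turns the real lower bound of [many_separated] into an inequality between
    natural numbers. *)
Lemma nat_ceil (R : realType) (x : R) :
  exists k : nat, x <= k%:R /\ forall m : nat, x <= m%:R -> (k <= m)%N.
Proof.
have ex : exists k : nat, x <= k%:R.
  exists (Num.bound `|x|); apply: le_trans (ler_norm x) _.
  by apply: ltW; apply: archi_boundP.
by have [k xk kmin] := ex_minnP ex; exists k.
Qed.

Lemma near0_ln_ge (R : realType) (B : R) : \forall e \near (0 : R)^'+, B <= - ln e.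
Proof.
near=> e; have e0 : 0 < e by [].
rewrite lerNr -[leRHS]expRK ler_ln ?posrE ?expR_gt0//.
by near: e; apply: nbhs_right_le; exact: expR_gt0.
Unshelve. all: by end_near. Qed.

Section mmdim.
Context {R : realType} {X : pointedMetricType R}.
Variables (rho : probability (g_sigma_algebraType (@open X)) R) (s c r0 : R).
Hypothesis c1 : 1 <= c.
Hypothesis reg : forall (x : X) (r : R), 0 < r -> r <= r0 ->
  ((c^-1 * r `^ s)%:E <= rho (metric_closed_ball mdist x r)
        <= (c * r `^ s)%:E)%E.
Variables (D : R) (phi : (nat -> X) -> R) (M beta : R).
Hypothesis mD : forall a b : X, mdist a b <= D.
Hypothesis phiM : forall x, `|phi x| <= M.
Hypothesis phi_unif : forall eta : R, 0 < eta -> exists t : R, [/\ 0 < t, t <= r0 &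
  forall x y, (forall n, mdist (x n) (y n) <= t) -> `|phi x - phi y| <= eta].
Local Notation T := (@left_shift R X).
Local Notation sd := (@seq_dist R X).
Hypothesis beta_ge : forall N eta, 0 < eta ->
  exists x, N%:R * (beta - eta) <= birkhoff_sum T phi N x.
Hypothesis beta_le : forall eta, 0 < eta ->
  exists C, forall N x, birkhoff_sum T phi N x <= N%:R * (beta + eta) + C.

Lemma ln_covering_net : exists A : R, forall r, 0 < r -> r <= r0 ->
  exists l : seq X, [/\ separated r l, forall z, exists2 y, y \in l & mdist y z <= r &
      ln (size l)%:R <= A + s * - ln r].
Proof.
exists (ln (c * 2 `^ s)) => r rp rr0.
have [l [sl lz ls]] := covering_net c1 reg rp rr0.
exists l; split => //.
have p2 : 0 < c * 2 `^ s by rewrite mulr_gt0 ?powR_gt0// (lt_le_trans ltr01).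
have pr : 0 < r `^ (- s) by rewrite powR_gt0.
rewrite mulrN -mulNr -ln_powR -lnM ?posrE// ler_ln ?posrE//; last exact: mulr_gt0.
by rewrite ltr0n; have [y] := lz point; case: l {sl lz ls}.
Qed.

(** The radius [t] comes from the modulus of continuity of [phi] and is fixed before [e]. Hence
    [ln t] and the regularity constants are bounded terms, negligible against [- ln e]. *)
Lemma entropy_at_scale_le_ge (eta : R) : 0 < eta ->
  exists A B : R, \forall e \near 0^'+,
    ((- A + (s + beta - eta) * - ln e)%:E <= entropy_at_scale sd T phi e
      <= (B + (s + beta + eta) * - ln e)%:E)%E.
Proof.
move=> eta0; have eta20 : 0 < eta / 2 by rewrite divr_gt0.
have [B netB] := ln_covering_net.
have [t [t0 tr0 phit]] := phi_unif eta20.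
have [C SC] := beta_le eta0.
have c0 : 0 < c by exact: lt_le_trans c1.
exists (ln (c ^+ 2) - s * ln t), (B + s * ln 16).
near=> e.
have e0 : 0 < e by [].
have e1 : e < 1 by near: e; exact: nbhs_right_lt.
have et : e <= t by near: e; exact: nbhs_right_le.
have e01 : 0 < e < 1 by rewrite e0.
have e160 : 0 < e / 16 by rewrite divr_gt0.
have e16r : e / 16 <= r0 by lra.
have [l [sl lz ls]] := netB _ e160 e16r.
have lne : 0 < - ln e by rewrite oppr_gt0 ln_lt0.
have [C' C'P] := shift_cover_le mD e01 lz SC.
have [k [kge kmin]] := nat_ceil (c ^- 2 * (t / e) `^ s).
have pos : 0 < c ^- 2 * (t / e) `^ s.
  by rewrite mulr_gt0 ?invr_gt0 ?exprn_gt0// powR_gt0// divr_gt0.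
have k0 : (0 < k)%N by rewrite -(ltr0n R) (lt_le_trans pos).
have kP x : exists l : seq X, [/\ separated e l,
     {in l, forall y, mdist x y <= t} & (k <= size l)%N].
  have [l' [sl' l't l's]] := many_separated c1 reg x t0 tr0 e0 (le_trans et tr0).
  by exists l'; split => //; exact: kmin.
have lower := shift_cover_ge mD phiM e01 k0 (ltW t0) kP (fun N => beta_ge N eta20) phit.
have := entropy_at_scale_bounds phiM e01 (fun N => introT andP (conj (lower N) (C'P N))).
move=> /andP[h1 h2]; apply/andP; split.
- apply: le_trans h1; rewrite lee_fin.
  have : ln (c ^- 2 * (t / e) `^ s) <= ln (k%:R : R) by rewrite ler_ln ?posrE// ltr0n.
  rewrite lnM ?posrE ?invr_gt0 ?exprn_gt0 ?powR_gt0 ?divr_gt0//.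
  rewrite lnV ?posrE ?exprn_gt0// ln_powR ln_div ?posrE//.
  nra.
- apply: (le_trans h2); rewrite lee_fin.
  move: ls; rewrite ln_div ?posrE//; lra.
Unshelve. all: by end_near. Qed.

Lemma upper_mmdim_shift : upper_mmdim sd T phi = (s + beta)%:E.
Proof.
apply/eqP; rewrite eq_le; apply/andP; split.
- apply: limf_esup_le => eta eta0.
  have eta20 : 0 < eta / 2 by rewrite divr_gt0.
  have [A [B HAB]] := entropy_at_scale_le_ge eta20.
  near=> e.
  have e0 : 0 < e by [].
  have e1 : e < 1 by near: e; exact: nbhs_right_lt.
  have lne : 0 < - ln e by rewrite oppr_gt0 ln_lt0// e0.
  have Be : B / (eta / 2) <= - ln e by near: e; exact: near0_ln_ge.
  have /andP[_ h] : ((- A + (s + beta - eta / 2) * - ln e)%:E <=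
    entropy_at_scale sd T phi e <= (B + (s + beta + eta / 2) * - ln e)%:E)%E.
    by near: e.
  have lnE : `|ln e| = - ln e by rewrite ler0_norm// ltW// -oppr_gt0.
  apply: le_trans (lee_wpmul2r _ h) _; first by rewrite lee_fin invr_ge0.
  rewrite -EFinM lee_fin lnE ler_pdivrMr//.
  move: Be; rewrite ler_pdivrMr//; lra.
- apply: limf_esup_ge => eta eta0.
  have eta20 : 0 < eta / 2 by rewrite divr_gt0.
  have [A [B HAB]] := entropy_at_scale_le_ge eta20.
  near=> e.
  have e0 : 0 < e by [].
  have e1 : e < 1 by near: e; exact: nbhs_right_lt.
  have lne : 0 < - ln e by rewrite oppr_gt0 ln_lt0// e0.
  have Ae : A / (eta / 2) <= - ln e by near: e; exact: near0_ln_ge.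
  have /andP[h _] : ((- A + (s + beta - eta / 2) * - ln e)%:E <=
    entropy_at_scale sd T phi e <= (B + (s + beta + eta / 2) * - ln e)%:E)%E.
    by near: e.
  have lnE : `|ln e| = - ln e by rewrite ler0_norm// ltW// -oppr_gt0.
  apply: le_trans (lee_wpmul2r _ h); last by rewrite lee_fin invr_ge0.
  rewrite -EFinM lee_fin lnE ler_pdivlMr//.
  move: Ae; rewrite ler_pdivrMr//; lra.
Unshelve. all: by end_near. Qed.

End mmdim.

(** * Upper bounds over invariant measures *)

Lemma measurable_finite_fibers d1 d2 (T1 : measurableType d1)
    (T2 : measurableType d2) (A : finType) (b : T1 -> A) (y : A -> T2) :
  (forall a, measurable (b @^-1` [set a])) -> measurable_fun setT (y \o b).
Proof.
move=> mb _ B mB; rewrite setTI.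
rewrite (_ : _ @^-1` B = \bigcup_(a in [set a | B (y a)]) b @^-1` [set a]).
  by apply: fin_bigcup_measurable => // a _.
apply/seteqP; split => [x Bx|x [a Ba ba]]; first by exists (b x).
by rewrite /preimage /= ba.
Qed.

Section shift_borel.
Context {R : realType} {X : pointedMetricType R}.
Variable D : R.
Hypothesis mD : forall a b : X, mdist a b <= D.
Local Notation T := (@left_shift R X).
Local Notation sd := (@seq_dist R X).
Local Notation Om := (borel sd).

Lemma measurable_coordinate_gt (y : X) k r :
  measurable ([set x | r < mdist y (x k)] : set Om).
Proof.
apply: sub_sigma_algebra => x /= rx.
exists (2 ^- k * (mdist y (x k) - r)).
  by rewrite mulr_gt0 ?invr_gt0 ?exprn_gt0// subr_gt0.
move=> z /(le_lt_trans (seq_dist_ge_term mD _ _ k)).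
rewrite ltr_pM2l ?invr_gt0 ?exprn_gt0// => xz.
by have := metric_triangle y (z k) (x k); rewrite (metric_sym (z k)) /=; lra.
Qed.

Lemma measurable_coordinate_le (y : X) k r :
  measurable ([set x | mdist y (x k) <= r] : set Om).
Proof.
rewrite (_ : [set x | _] = ~` [set x | r < mdist y (x k)]).
  by apply: measurableC; exact: measurable_coordinate_gt.
by apply/seteqP; split=> x /=; rewrite leNgt => /negP.
Qed.

(* The index is [size l] when no point of [l] is within [r] of [x]. *)
Definition quantize (l : seq X) (r : R) (x : X) : nat := find (fun y => mdist y x <= r) l.

Lemma measurable_quantize (l : seq X) r k n :
  measurable ([set x | quantize l r (x k) = n] : set Om).
Proof.
elim: l n => [|y l IH] n.
  rewrite /quantize/=; have [->|n0] := eqVneq n 0%N.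
    by rewrite (_ : [set x | _] = setT)//; apply/seteqP; split.
  by rewrite (_ : [set x | _] = set0)//; apply/seteqP; split => // x /= h; rewrite -h in n0.
pose A : set Om := [set x | mdist y (x k) <= r].
have mA : measurable A by exact: measurable_coordinate_le.
case: n => [|n].
  rewrite (_ : [set x | _] = A)//; apply/seteqP; rewrite /A /quantize; split => x /=.
    by case: ifP.
  by move=> ->.
rewrite (_ : [set x | _] = ~` A `&` [set x | quantize l r (x k) = n]).
  by apply: measurableI => //; exact: measurableC.
apply/seteqP; rewrite /A /quantize; split => x /=.
  by case: ifP => // h [<-]; split.
by move=> [/negP/negbTE -> ->].
Qed.

Lemma measurable_cells (l : seq X) r n (w : 'I_n -> nat) :
  measurable [set x : Om | forall k : 'I_n, quantize l r (x k) = w k].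
Proof.
rewrite [X in measurable X](_ : _ =
    \bigcap_(k in setT) [set x : Om | quantize l r (x (val (k : 'I_n))) = w k]).
  by apply: fin_bigcap_measurable => // k _; exact: measurable_quantize.
by apply/seteqP; split => x H; [move=> k _; exact: H|move=> k; exact: (H k Logic.I)].
Qed.

Lemma quantizeP (l : seq X) (r : R) x :
  (exists2 y, y \in l & mdist y x <= r) ->
  (quantize l r x < size l)%N /\ mdist (nth point l (quantize l r x)) x <= r.
Proof.
move=> [y yl yx].
have h : has (fun y => mdist y x <= r) l by apply/hasP; exists y.
by rewrite /quantize -has_find; split => //; exact: (nth_find point h).
Qed.

Lemma measurable_left_shift : measurable_fun setT (T : Om -> Om).
Proof.
apply: (@measurability _ _ Om Om setT T (open_for sd) erefl) => // _ [A oA <-]; rewrite setTI.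
apply: sub_sigma_algebra => x /= Ax; have [e e0 H] := oA _ Ax.
exists (e / 2); first by rewrite divr_gt0.
move=> y xy; apply: H.
have := seq_dist_rec mD x y; have := mdist_ge0 (x 0%N) (y 0%N); lra.
Qed.

End shift_borel.

Lemma sum_geometric_half (R : realType) n :
  \sum_(k < n) 2 ^- (n - k) <= 1 :> R.
Proof.
elim: n => [|n IH]; first by rewrite big_ord0.
rewrite big_ord_recr/= subSnn expr1.
rewrite (eq_bigr (fun k : 'I_n => 2^-1 * 2 ^- (n - k))); last first.
  by move=> k _; rewrite subSn ?exprS ?invfM// ltnW.
rewrite -mulr_sumr; lra.
Qed.

Section rdim_upper.
Context {R : realType} {X : pointedMetricType R}.
Variable D : R.
Hypothesis mD : forall a b : X, mdist a b <= D.
Local Notation T := (@left_shift R X).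
Local Notation sd := (@seq_dist R X).
Local Notation Om := (borel sd).
Variable mu : probability Om R.

Lemma rate_distortion_le (e : R) (l : seq X) : 0 < e ->
  (forall z, exists2 y, y \in l & mdist y z <= e / 8) ->
  (rate_distortion T mu e <= (ln (size l)%:R)%:E)%E.
Proof.
(* The reproduction records the quantised first [n] coordinates only; the
   missing tails cost at most [2 * D] in the sum of the [n] distances. *)
move=> e0 lnet.
have D0 : 0 <= D by exact: le_trans (mdist_ge0 _ _) (mD point point).
(* The first [n] coordinates cost [2 * (e / 8)] per term, and this [n] makes the tail cost
   [2 * D / n] at most [e / 4]: together at most [e / 2]. *)
have [n [nP _]] := nat_ceil (8 * D / e + 1).
have n0 : (0 < n)%N by rewrite -(ltr0n R) (lt_le_trans _ nP)// ltr_wpDl// divr_ge0 ?mulr_ge0// ltW.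
pose B := {ffun 'I_n -> 'I_(size l)}.
pose b (w : Om) : B := [ffun j : 'I_n => Ordinal (quantizeP (lnet (w j))).1].
pose y (v : B) : n.-tuple Om := [tuple (fun i => if insub (i + k)%N is Some j
  then nth point l (v j) else point) | k < n].
have mb v : measurable (b @^-1` [set v]).
  rewrite (_ : _ @^-1` _ = [set x : Om | forall j : 'I_n, quantize l (e / 8) (x j) = v j]).
    exact: (measurable_cells mD).
  apply/seteqP; split => w.
    by move=> /= <- j /=; rewrite ffunE.
  by move=> H; apply/ffunP => j; rewrite ffunE; apply/val_inj; exact: H.
have mZ : measurable_fun setT (y \o b).
  exact: measurable_finite_fibers.
have [Z ZE] : exists Z : {RV mu >-> n.-tuple Om}, (Z : Om -> n.-tuple Om) = y \o b.
  by exists (mfun_Sub (mem_set mZ)).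
have mI : measurable_fun setT (id : Om -> Om) by exact: measurable_id.
have [I IE] : exists I : {RV mu >-> Om}, (I : Om -> Om) = id.
  by exists (mfun_Sub (mem_set mI)).
apply: (@le_trans _ _ (mutual_information mu I Z * (n%:R^-1)%:E)%E).
  apply: ereal_inf_lbound; exists n, _, Om, mu, I, Z; split => //.
    by move=> A _; rewrite IE.
  apply: (@le_lt_trans _ _ (e / 2)%:E); last by rewrite lte_fin; lra.
  rewrite unlock.
  apply: (@le_trans _ _ (\int[mu]_x (e / 2)%:E)%E); last first.
    by rewrite integral_cst//= probability_setT mule1.
  apply: ge0_integral_le_nonmeasurable => w.
    by rewrite lee_fin mulr_ge0 ?invr_ge0// sumr_ge0// => k _; exact: (seq_dist_ge0 mD).
  rewrite lee_fin ler_pdivrMl ?ltr0n//.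
  apply: (@le_trans _ _ (\sum_(k < n) (2 * (e / 8) + 2 ^- (n - k) * (2 * D)))).
    apply: ler_sum => k _; rewrite IE ZE tnth_mktuple.
    apply: (seq_dist_le_prefix mD); first lra.
    move=> i ik; rewrite iter_shift; have ikn : (i + k < n)%N by rewrite addnC -ltn_subRL.
    rewrite insubT ffunE metric_sym /=.
    by have [_] := quantizeP (lnet (w (i + k)%N)).
  rewrite big_split/= sumr_const card_ord -mulr_suml -[_ *+ n]mulr_natr.
  have := sum_geometric_half R n.
  set G := \sum_(i < n) _ => G1.
  have : G * (2 * D) <= 2 * D by rewrite ler_piMl// mulr_ge0.
  have : 8 * D <= n%:R * e.
    rewrite -ler_pdivrMr//; lra.
  lra.
have h : (mutual_information mu I Z <= (ln #|B|%:R)%:E)%E.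
  apply: (@mutual_information_le _ _ _ mu _ _ _ _ _ _ _ y); rewrite ?IE ?ZE//.
  by move=> w; exists (b w).
apply: le_trans (lee_wpmul2r _ h) _; first by rewrite lee_fin invr_ge0.
rewrite -EFinM lee_fin card_ffun !card_ord natrX lnXn; last first.
  by rewrite ltr0n; have [z] := lnet point; case: l {lnet b y mb mZ Z ZE I IE h B}.
by rewrite -[ln _ *+ n]mulr_natr mulfK// pnatr_eq0 -lt0n.
Qed.

End rdim_upper.

Section rdim_upper_bound.
Context {R : realType} {X : pointedMetricType R}.
Variables (rho : probability (g_sigma_algebraType (@open X)) R) (s c r0 D : R).
Hypotheses (c1 : 1 <= c) (r00 : 0 < r0).
Hypothesis reg : forall (x : X) (r : R), 0 < r -> r <= r0 ->
  ((c^-1 * r `^ s)%:E <= rho (metric_closed_ball mdist x r)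
        <= (c * r `^ s)%:E)%E.
Hypothesis mD : forall a b : X, mdist a b <= D.

Lemma upper_rdim_le (mu : probability (borel (@seq_dist R X)) R) :
  (upper_rdim (@left_shift R X) mu <= s%:E)%E.
Proof.
have [A netA] := ln_covering_net c1 reg.
apply: limf_esup_le => eta eta0.
near=> e.
have e0 : 0 < e by [].
have e1 : e < 1 by near: e; exact: nbhs_right_lt.
have er : e <= r0 by near: e; exact: nbhs_right_le.
have lne : 0 < - ln e by rewrite oppr_gt0 ln_lt0// e0.
have Ae : (A + s * ln 8) / eta <= - ln e by near: e; exact: near0_ln_ge.
have e80 : 0 < e / 8 by rewrite divr_gt0.
have e8r : e / 8 <= r0 by lra.
have [l [_ lz ls]] := netA _ e80 e8r.
have lnE : `|ln e| = - ln e by rewrite ler0_norm// ltW// -oppr_gt0.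
apply: le_trans (lee_wpmul2r _ (rate_distortion_le mD mu e0 lz)) _.
  by rewrite lee_fin invr_ge0.
rewrite -EFinM lee_fin lnE ler_pdivrMr//.
move: ls Ae; rewrite ler_pdivrMr// ln_div ?posrE//; lra.
Unshelve. all: by end_near. Qed.

End rdim_upper_bound.

Section invariant_integral.
Context {R : realType} {X : pointedMetricType R}.
Variable D : R.
Hypothesis mD : forall a b : X, mdist a b <= D.
Local Notation T := (@left_shift R X).
Local Notation sd := (@seq_dist R X).
Local Notation Om := (borel sd).
Variables (mu : probability Om R) (phi : Om -> R) (M : R).
Hypothesis mu_inv : invariant_measure T mu.
Hypothesis phiM : forall x, `|phi x| <= M.
Hypothesis mphi : measurable_fun setT phi.

Lemma bounded_integrable (f : Om -> R) (B : R) : measurable_fun setT f ->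
  (forall x, `|f x| <= B) -> mu.-integrable setT (EFin \o f).
Proof.
move=> mf fB; apply: measurable_bounded_integrable => //.
  by rewrite (le_lt_trans (probability_le1 _ _))// ltry.
by exists B; split; [exact: num_real|move=> b Bb x _; exact: le_trans (fB x) (ltW Bb)].
Qed.

Lemma integral_shift (f : Om -> R) (B : R) : measurable_fun setT f ->
  (forall x, `|f x| <= B) ->
  (\int[mu]_x (f (T x))%:E = \int[mu]_x (f x)%:E)%E.
Proof.
move=> mf fB; have mT := measurable_left_shift mD.
have intfT : mu.-integrable (T @^-1` setT) ((EFin \o f) \o T).
  rewrite preimage_setT; apply: (@bounded_integrable (f \o T) B).
    exact: measurableT_comp.
  by move=> x; exact: fB.
have mf' : measurable_fun setT (EFin \o f) by exact/measurable_EFinP.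
rewrite -[LHS](@integral_pushforward _ _ Om Om R T mT mu setT _ mf' intfT measurableT).
by apply: eq_measure_integral => A mA _; exact: mu_inv.
Qed.

Let measurable_iter n : measurable_fun setT (iter n T : Om -> Om).
Proof.
elim: n => [|n IH]; first exact: measurable_id.
exact: (measurableT_comp (measurable_left_shift mD) IH).
Qed.

Lemma measurable_birkhoff_sum N : measurable_fun setT (birkhoff_sum T phi N : Om -> R).
Proof.
elim: N => [|N IH].
  rewrite (_ : birkhoff_sum T phi 0 = cst 0); first exact: measurable_cst.
  by apply/funext => x; rewrite /birkhoff_sum big_ord0.
rewrite (_ : birkhoff_sum T phi N.+1 = (birkhoff_sum T phi N : Om -> R) \+ (phi \o iter N T)).
  by apply: measurable_funD => //; exact: measurableT_comp.
by apply/funext => x; rewrite /birkhoff_sum big_ord_recr.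
Qed.

Lemma integral_birkhoff_sum N :
  (\int[mu]_x (birkhoff_sum T phi N x)%:E =
    N%:R%:E * \int[mu]_x (phi x)%:E)%E.
Proof.
have it n : (\int[mu]_x (phi (iter n T x))%:E = \int[mu]_x (phi x)%:E)%E.
  elim: n => // n IH; rewrite -IH.
  rewrite -(@integral_shift (phi \o iter n T) M); last 2 first.
  - exact: measurableT_comp.
  - by move=> x; exact: phiM.
  by apply: eq_integral => x _; rewrite iterSr.
have int n : mu.-integrable setT (EFin \o (phi \o iter n T)).
  apply: (@bounded_integrable _ M); first exact: measurableT_comp.
  by move=> x; exact: phiM.
have fin : (\int[mu]_x (phi x)%:E)%E \is a fin_num.
  exact: integrable_fin_num (int 0%N).
elim: N => [|N IH].
  rewrite mul0e -[RHS](integral0 mu setT); apply: eq_integral => x _.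
  by rewrite /birkhoff_sum big_ord0.
rewrite (eq_integral (fun x : Om => ((birkhoff_sum T phi N x)%:E + (phi (iter N T x))%:E)%E)); last first.
  by move=> x _; rewrite /birkhoff_sum big_ord_recr.
rewrite integralD_EFin//; last 2 first.
- apply: (@bounded_integrable _ (N%:R * M)); first exact: measurable_birkhoff_sum.
  exact: birkhoff_sum_norm.
- exact: int.
by rewrite IH it -natr1 -(fineK fin) -EFinM -EFinD -EFinM mulrDl mul1r.
Qed.

Lemma fine_integral_birkhoff_sum N :
  fine (\int[mu]_x (birkhoff_sum T phi N x)%:E)%E =
    N%:R * fine (\int[mu]_x (phi x)%:E)%E.
Proof.
have fin : (\int[mu]_x (phi x)%:E)%E \is a fin_num.
  exact: integrable_fin_num (bounded_integrable mphi phiM).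
by rewrite integral_birkhoff_sum -{1}(fineK fin) -EFinM.
Qed.

(** By invariance [phi] may be replaced by [S_N phi / N], which is at most [beta + eta / 2 + C / N]
    pointwise; then [N] is taken large. *)
Lemma integral_potential_le (beta : R) :
  (forall eta, 0 < eta ->
    exists C, forall N x, birkhoff_sum T phi N x <= N%:R * (beta + eta) + C) ->
  (\int[mu]_x (phi x)%:E <= beta%:E)%E.
Proof.
move=> betaP.
have fin : (\int[mu]_x (phi x)%:E)%E \is a fin_num.
  exact: integrable_fin_num (bounded_integrable mphi phiM).
rewrite -(fineK fin) lee_fin; set I := fine _.
apply/ler_addgt0Pr => eta eta0.
have e20 : 0 < eta / 2 by rewrite divr_gt0.
have [C CP] := betaP _ e20.
have [N [NP _]] := nat_ceil (`|C| / (eta / 2) + 1).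
have N0 : (0 : R) < N%:R by rewrite (lt_le_trans _ NP)// ltr_wpDl// divr_ge0// ltW.
have mS := measurable_birkhoff_sum N.
have iS : mu.-integrable setT (EFin \o birkhoff_sum T phi N).
  by apply: (@bounded_integrable _ (N%:R * M)) => // x; exact: birkhoff_sum_norm.
have : (\int[mu]_x (birkhoff_sum T phi N x)%:E <=
    \int[mu]_x (N%:R * (beta + eta / 2) + C)%:E)%E.
  apply: le_integral => //.
    apply: (@bounded_integrable _ (`|N%:R * (beta + eta / 2) + C|)) => //.
  by move=> x _; rewrite lee_fin.
rewrite integral_cst//= probability_setT mule1.
rewrite -(fineK (integrable_fin_num _ iS))// lee_fin fine_integral_birkhoff_sum -/I.
move: NP; have : `|C| / (eta / 2) * (eta / 2) = `|C| by rewrite divfK// gt_eqF.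
set q := `|C| / _ => qE NP h.
have hC := ler_norm C.
have hq : q * (eta / 2) <= N%:R * (eta / 2) by rewrite ler_pM2r//; lra.
rewrite -(ler_pM2l N0); lra.
Qed.

Lemma integral_potential_ge (N : nat) (b : R) : (0 < N)%N ->
  mu [set x | birkhoff_sum T phi N x < N%:R * b] = 0%E ->
  (b%:E <= \int[mu]_x (phi x)%:E)%E.
Proof.
move=> N0 mu0.
have fin : (\int[mu]_x (phi x)%:E)%E \is a fin_num.
  exact: integrable_fin_num (bounded_integrable mphi phiM).
have mS := measurable_birkhoff_sum N.
have iS : mu.-integrable setT (EFin \o birkhoff_sum T phi N).
  by apply: (@bounded_integrable _ (N%:R * M)) => // x; exact: birkhoff_sum_norm.
(* The lower bound holds almost everywhere only; [g] satisfies it everywhere and differs from the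
   Birkhoff sum on a null set. *)
pose g x := Num.max (birkhoff_sum T phi N x) (N%:R * b).
have mg : measurable_fun setT (g : Om -> R).
  by apply: measurable_maxr => //; exact: measurable_cst.
have ig : mu.-integrable setT (EFin \o (g : Om -> R)).
  apply: (@bounded_integrable _ (N%:R * M + `|N%:R * b|)) => // x.
  have h := birkhoff_sum_norm T phiM N x.
  rewrite /g; have [_|_] := leP (birkhoff_sum T phi N x) (N%:R * b).
    by rewrite lerDr (le_trans _ h).
  by rewrite (le_trans h)// lerDl.
have : ((N%:R * b)%:E <= \int[mu]_x (g x)%:E)%E.
  rewrite -[leLHS]mule1 -(@probability_setT _ _ _ mu) -(integral_cst mu measurableT).
  apply: le_integral => //.
    apply: (@bounded_integrable _ (`|N%:R * b|)) => //.
  by move=> x _; rewrite lee_fin /g le_max lexx orbT.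
have -> : (\int[mu]_x (g x)%:E = \int[mu]_x (birkhoff_sum T phi N x)%:E)%E.
  apply: ae_eq_integral => //; try exact/measurable_EFinP.
  exists [set x | birkhoff_sum T phi N x < N%:R * b]; split => //.
    rewrite (_ : [set x | _] = birkhoff_sum T phi N @^-1` `]-oo, (N%:R * b)[).
      rewrite -[X in measurable X]setTI; exact: mS.
    by apply/seteqP; split => x /=; rewrite in_itv.
  move=> x /= h; rewrite ltNge; apply/negP => h2; apply: h => _.
  by rewrite /g; congr (_%:E); apply/max_idPl.
rewrite -(fineK (integrable_fin_num _ iS))// lee_fin fine_integral_birkhoff_sum.
by rewrite ler_pM2l ?ltr0n// -lee_fin fineK.
Qed.

End invariant_integral.

(** * A Fano-type lower bound for the rate distortion function *)

Section rate_lower.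
Context {R : realType} {X : pointedMetricType R}.
Variable D : R.
Hypothesis mD : forall a b : X, mdist a b <= D.
Local Notation T := (@left_shift R X).
Local Notation sd := (@seq_dist R X).
Local Notation Om := (borel sd).
Variables (mu : probability Om R) (e kappa E : R) (l : seq X) (Bc : nat).
Hypotheses (e0 : 0 < e) (kappa0 : 0 < kappa) (Bc0 : (0 < Bc)%N).
Hypothesis lnet : forall z, exists2 y, y \in l & mdist y z <= e.
Hypothesis lcount : forall y, (count (fun z => (mdist y z <= (kappa + 2) * e)%R) l <= Bc)%N.
Hypothesis muE : forall n (w : 'I_n -> nat),
  (mu [set x : Om | forall k : 'I_n, quantize l e (x k) = w k] <= (expR (- (n%:R * E)))%:E)%E.

Local Notation K := (size l).
Local Notation Q x := (Ordinal (quantizeP (lnet x)).1 : 'I_K).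

(* [expR (h1 i j)] guesses the centre [i] of a source coordinate from the centre
   [j] of its reproduction: half of the mass is shared by the at most [Bc]
   centres close to [j], half by all the centres. *)
Let near_ij (i j : 'I_K) := mdist (nth point l j) (nth point l i) <= (kappa + 2) * e.

Let h1 (i j : 'I_K) : R := - ln (2 * (if near_ij i j then Bc else K)%:R).

Let K0 : (0 < K)%N.
Proof. by have [z] := lnet point; case: l. Qed.

Let sum_exp_h1 j : \sum_i expR (h1 i j) <= 1.
Proof.
have p2 (m : nat) : (0 < m)%N -> expR (- ln (2 * m%:R)) = 2^-1 / m%:R :> R.
  by move=> m0; rewrite expRN lnK ?posrE ?mulr_gt0 ?ltr0n// invfM.
rewrite (bigID (near_ij^~ j))/=.
rewrite (eq_bigr (fun=> 2^-1 / Bc%:R)); last by move=> i ij; rewrite /h1 ij p2.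
rewrite [X in _ + X](eq_bigr (fun=> 2^-1 / K%:R)); last first.
  by move=> i /negbTE ij; rewrite /h1 ij p2.
rewrite [leRHS](_ : _ = 2^-1 + 2^-1); last by lra.
rewrite !sumr_const; apply: lerD.
  rewrite -[_ *+ _]mulr_natr -mulrA ler_piMr//.
  rewrite mulrC ler_pdivrMr ?ltr0n// mul1r ler_nat.
  apply: leq_trans (lcount (nth point l j)).
  rewrite -sum1_card -sum1_count [leqRHS](big_nth point)/= big_mkord.
  by rewrite leq_eqVlt; apply/orP; left; apply/eqP; apply: eq_bigl => i.
rewrite -[_ *+ _]mulr_natr -mulrA ler_piMr//.
rewrite mulrC ler_pdivrMr ?ltr0n// mul1r ler_nat.
by rewrite -[leqRHS]card_ord max_card.
Qed.

Let h1_ge i j : - ln (2 * Bc%:R) - (~~ near_ij i j)%:R * ln (2 * K%:R) <= h1 i j.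
Proof.
have hB : 0 <= ln (2 * Bc%:R) :> R.
  by rewrite ln_ge0// -natrM ler1n muln_gt0.
have hK : 0 <= ln (2 * K%:R) :> R by rewrite ln_ge0// -natrM ler1n muln_gt0/= K0.
rewrite /h1; case: (near_ij i j); rewrite ?mul0r ?subr0// mul1r; lra.
Qed.

(** A cell of the source carries information at least [E] per coordinate. Guessing it from the
    reproduction costs [ln (2 * Bc)] per coordinate, and at most [ln (2 * K)] more where the two
    centres are far. A far coordinate contributes at least [kappa * e] to the distortion, so on
    average at most a proportion [kappa^-1] of them is far. *)
Lemma rate_distortion_ge :
  ((E - ln (2 * Bc%:R) - kappa^-1 * ln (2 * K%:R))%:E <= rate_distortion T mu e)%E.
Proof.
have lnK0 : 0 <= ln (2 * K%:R) :> R.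
  by rewrite ln_ge0// -natrM ler1n muln_gt0/= K0.
apply: le_ereal_inf_tmp => _ [n [dO [Om0 [P [I [Z [n0 IP dist ->]]]]]]].
pose A := {ffun 'I_n -> 'I_K}.
pose F (x : Om) : A := [ffun k : 'I_n => Q (x k)].
pose G (z : n.-tuple Om) : A := [ffun k : 'I_n => Q (tnth z k 0%N)].
have FE a : F @^-1` [set a] = [set x : Om | forall k : 'I_n, quantize l e (x k) = a k].
  apply/seteqP; split => x /=; first by move=> <- k; rewrite ffunE.
  by move=> H; apply/ffunP => k; rewrite ffunE; apply/val_inj/H.
have mF a : measurable (F @^-1` [set a]).
  by rewrite FE; exact: (measurable_cells mD).
have mG b : measurable (G @^-1` [set b]).
  rewrite (_ : _ @^-1` _ = \bigcap_(k in setT) ((fun z : n.-tuple Om => tnth z (k : 'I_n)) @^-1` [set x : Om | quantize l e (x 0%N) = b k])).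
    apply: fin_bigcap_measurable => // k _.
    rewrite -[X in measurable X]setTI; apply: measurable_tnth => //.
    exact: (measurable_quantize mD).
  apply/seteqP; split => z /=; first by move=> <- k _ /=; rewrite ffunE.
  by move=> H; apply/ffunP => k; rewrite ffunE; apply/val_inj; exact: (H k Logic.I).
(* Guesses multiply over coordinates, so their total mass is a product of sums each at most 1. *)
pose h (a b : A) : R := \sum_(k < n) h1 (a k) (b k).
have hb b : \sum_a expR (h a b) <= 1.
  rewrite (eq_bigr (fun a : A => \prod_(k < n) expR (h1 (a k) (b k)))); last first.
    by move=> a _; rewrite expR_sum.
  rewrite -(bigA_distr_bigA (fun k i => expR (h1 i (b k)))).
  apply: prodr_ile1 => k _; rewrite sum_exp_h1 andbT.
  by apply: sumr_ge0 => i _; exact: expR_ge0.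
have mI : measurable_fun setT (I : Om0 -> Om) by exact: measurable_funPT.
have mZ : measurable_fun setT (Z : Om0 -> n.-tuple Om) by exact: measurable_funPT.
have pE a : fine (P (I @^-1` (F @^-1` [set a]))) <= expR (- (n%:R * E)).
  rewrite IP// -lee_fin fineK ?fin_num_measure// FE; exact: muE.
have main := mutual_information_ge mI mZ mF mG pE hb.
apply: (le_trans _ (lee_wpmul2r _ main)); last by rewrite lee_fin invr_ge0.
rewrite -EFinM lee_fin ler_pdivlMr ?ltr0n//.
pose far (ab : A * A) : R := \sum_(k < n) (~~ near_ij (ab.1 k) (ab.2 k))%:R.
have far0 ab : 0 <= far ab by exact: sumr_ge0.
pose f w := (F (I w), G (Z w)).
have fE ab : f @^-1` [set ab] = (F \o I) @^-1` [set ab.1] `&` (G \o Z) @^-1` [set ab.2].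
  by apply/seteqP; split => w; rewrite /f /= ; [move=> <-|case: ab => a b /= [-> ->]].
have mf ab : measurable (f @^-1` [set ab]).
  rewrite fE; apply: measurableI; rewrite comp_preimage -[X in measurable X]setTI.
    exact: mI.
  exact: mZ.
pose p ab := fine (P (f @^-1` [set ab])).
have p1 : \sum_ab p ab = 1.
  rewrite -[RHS](_ : fine (P setT) = 1); last by rewrite probability_setT.
  rewrite (probability_sum_partition P (F := fun ab => f @^-1` [set ab]))//.
  + by apply: eq_bigr => ab _; rewrite setTI.
  + by move=> i k _ _ [w [/= <- <-]].
  + by move=> w _; exists (f w).
(* Far centres are more than [(kappa + 2) * e] apart; the two quantisation errors take [2 * e]. Only
   coordinate 0 of each reproduced sequence is read. *)
have far_dist w : kappa * e * far (f w) <=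
    \sum_(k < n) sd (iter k T (I w)) (tnth (Z w) k).
  rewrite /far mulr_sumr; apply: ler_sum => k _ /=.
  have sk : mdist (I w k) (tnth (Z w) k 0%N) <= sd (iter k T (I w)) (tnth (Z w) k).
    have := seq_dist_ge mD 0 (iter k T (I w)) (tnth (Z w) k).
    by rewrite iter_shift.
  case: (boolP (near_ij _ _)) => [_|/=]; rewrite ?mulr0 ?(seq_dist_ge0 mD)//.
  rewrite /near_ij -ltNge !ffunE mulr1 /=.
  have [_ h1'] := quantizeP (lnet (I w k)).
  have [_ h2'] := quantizeP (lnet (tnth (Z w) k 0%N)).
  set a := nth _ _ _ in h1' *; set b := nth _ _ _ in h2' *.
  have t1 := metric_triangle b (tnth (Z w) k 0%N) a.
  have t2 := metric_triangle (tnth (Z w) k 0%N) (I w k) a.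
  rewrite (metric_sym (tnth _ _ _) (I w k)) (metric_sym (I w k) a) in t2.
  lra.
have Sfar : \sum_ab p ab * far ab <= n%:R / kappa.
  have n0' : (0 : R) < n%:R by rewrite ltr0n.
  have := integral_finite_valued P mf
    (h := fun ab => n%:R^-1 * (kappa * e * far ab)).
  have pos ab : 0 <= n%:R^-1 * (kappa * e * far ab).
    by rewrite !mulr_ge0 ?invr_ge0// ltW.
  move=> /(_ pos) intE.
  have : (\int[P]_w (n%:R^-1 * (kappa * e * far (f w)))%:E < e%:E)%E.
    apply: le_lt_trans dist; rewrite unlock.
    apply: ge0_integral_le_nonmeasurable => w; rewrite lee_fin//.
    by rewrite ler_wpM2l ?invr_ge0.
  rewrite intE lte_fin => h'.
  rewrite ler_pdivlMr// -(ler_pM2r e0) -ler_pdivrMl// ltW//.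
  apply: le_lt_trans h'; rewrite !mulr_suml mulr_sumr.
  apply: ler_sum => ab _; rewrite -/(p ab).
  by rewrite le_eqVlt; apply/orP; left; apply/eqP; ring.
have -> : \sum_a \sum_b fine (P ((F \o I) @^-1` [set a] `&` (G \o Z) @^-1` [set b])) * h a b
    = \sum_ab p ab * h ab.1 ab.2.
  rewrite pair_big/=; apply: eq_bigr => -[a b] _ /=.
  by rewrite /p fE.
apply: (@le_trans _ _ (n%:R * E + \sum_ab p ab * (- (n%:R * ln (2 * Bc%:R)) - far ab * ln (2 * K%:R)))).
  under [in leRHS]eq_bigr do rewrite mulrBr mulrA.
  rewrite sumrB -mulr_suml p1 -mulr_suml mul1r.
  have := ler_wpM2r lnK0 Sfar.
  set S := \sum_ab _; lra.
rewrite lerD2l; apply: ler_sum => -[a b] _; rewrite ler_wpM2l//.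
  by apply: fine_ge0; exact: measure_ge0.
rewrite /h /far /= mulr_suml.
have -> : n%:R * ln (2 * Bc%:R) = \sum_(k < n) ln (2 * Bc%:R) :> R.
  by rewrite sumr_const card_ord mulr_natl.
rewrite -sumrN -sumrB; apply: ler_sum => k _; exact: h1_ge.
Qed.

End rate_lower.

(** * Independent digits of a uniform random variable *)

Section unit_lebesgue.
Context {R : realType}.
Local Notation mR := (measurableTypeR R).

(** Lebesgue measure of the unit interval, kept as a measure on the whole line so that the sample
    space is the usual Borel line. *)
Definition unit_lebesgue : set mR -> \bar R :=
  mrestr (@lebesgue_measure R) (measurable_itv `[(0:R), 1[).

HB.instance Definition _ := Measure.on unit_lebesgue.

Let unit_lebesgueT : unit_lebesgue setT = 1%E.
Proof.
by rewrite /unit_lebesgue /mrestr setTI lebesgue_measure_itv/= lte_fin ltr01 sube0.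
Qed.

HB.instance Definition _ := Measure_isProbability.Build _ _ _ unit_lebesgue unit_lebesgueT.

End unit_lebesgue.

Section digits.
Context {R : realType}.
Variable m : nat.
Local Notation M := m.+1.
Local Notation mR := (measurableTypeR R).
Local Notation P := (@unit_lebesgue R : probability mR R).

(* The norm keeps [Num.truncn] away from its junk value on negative reals. *)
Definition madic_digit (k : nat) (u : mR) : nat :=
  (Num.truncn (`|(u : R)| * M%:R ^+ k.+1) %% M)%N.

Lemma madic_digit_lt k u : (madic_digit k u < M)%N.
Proof. exact: ltn_pmod. Qed.

Lemma truncn_mul_divn (u : R) k : 0 <= u ->
  (Num.truncn (u * M%:R ^+ k.+1) %/ M)%N = Num.truncn (u * M%:R ^+ k).
Proof.
move=> u0; apply/esym/truncn_def.
have M0 : (0 : R) < M%:R by rewrite ltr0n.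
have : 0 <= u * M%:R ^+ k.+1 by rewrite mulr_ge0 ?exprn_ge0.
move=> /truncn_itv; set t := Num.truncn _ => /andP[t1 t2].
apply/andP; split.
- rewrite -(ler_pM2r M0) -mulrA -exprSr -natrM (le_trans _ t1)//.
  by rewrite ler_nat leq_trunc_div.
- rewrite -(ltr_pM2r M0) -mulrA -exprSr -natrM (lt_le_trans t2)//.
  by rewrite ler_nat ltn_ceil.
Qed.

Fixpoint prefix_value (w : nat -> nat) (k : nat) : nat :=
  if k is k'.+1 then (prefix_value w k' * M + w k')%N else 0.

Lemma prefix_value_lt w k : (forall i, (i < k)%N -> (w i < M)%N) ->
  (prefix_value w k < M ^ k)%N.
Proof.
elim: k => // k IH wM /=.
have := IH (fun i ik => wM i (leqW ik)); have := wM k (leqnn _).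
rewrite expnS mulnC; nia.
Qed.

(** The first [k] digits are the base-[M] expansion of the integer part of [u * M ^ k]. Prescribing
    them confines [u] to an interval of length [M ^ - k]. *)
Lemma digits_prefixP (u : R) (w : nat -> nat) k : 0 <= u < 1 ->
  (forall i, (i < k)%N -> (w i < M)%N) ->
  (forall i, (i < k)%N -> madic_digit i u = w i) <->
  Num.truncn (u * M%:R ^+ k) = prefix_value w k.
Proof.
move=> /andP[u0 u1]; elim: k => [|k IH] wM.
  by split => // _ /=; apply: truncn_def; rewrite expr0 mulr1 u0.
have {}IH := IH (fun i ik => wM i (leqW ik)).
have tE := truncn_mul_divn k u0.
have dE : madic_digit k u = (Num.truncn (u * M%:R ^+ k.+1) %% M)%N.
  by rewrite /madic_digit ger0_norm.
split=> [H|/= H].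
  rewrite /= (divn_eq (Num.truncn _) M) tE -dE H//.
  by rewrite (IH.1 (fun i ik => H i (leqW ik))).
have wk := wM k (leqnn _).
move=> i; rewrite ltnS leq_eqVlt => /predU1P[->|].
  by rewrite dE H modnMDl modn_small.
by apply: IH.2; rewrite -tE H divnMDl// divn_small// addn0.
Qed.

Lemma measurable_madic_digit k a : measurable (madic_digit k @^-1` [set a] : set mR).
Proof.
rewrite (_ : _ @^-1` _ = \bigcup_(t in [set t | (t %% M = a)%N])
   [set u : mR | t%:R <= `|(u : R)| * M%:R ^+ k.+1 < t.+1%:R]); last first.
  apply/seteqP; split => u.
    move=> /= H; exists (Num.truncn (`|(u : R)| * M%:R ^+ k.+1)) => //.
    by apply: truncn_itv; rewrite mulr_ge0 ?exprn_ge0.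
  by move=> [t /= ta H]; rewrite /madic_digit (truncn_def H).
apply: bigcup_measurable => t _.
pose f (u : mR) : R := `|(u : R)| * M%:R ^+ k.+1.
have mf : measurable_fun setT f.
  by apply: measurable_funM => //; exact: measurableT_comp.
rewrite (_ : [set u | _] = f @^-1` `[t%:R, t.+1%:R[).
  rewrite -[X in measurable X]setTI; apply: mf => //; exact: measurable_itv.
by apply/seteqP; split => u /=; rewrite in_itv.
Qed.

Lemma measurable_digits (p w : nat -> nat) k :
  measurable ([set u | forall i, (i < k)%N -> madic_digit (p i) u = w i] : set mR).
Proof.
rewrite (_ : [set u | _] = \bigcap_(i in `I_k) (madic_digit (p i) @^-1` [set w i])).
  by apply: fin_bigcap_measurable => // i _; exact: measurable_madic_digit.
by apply/seteqP; split => u H i ik; exact: H.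
Qed.

Lemma prob_digits_prefix (w : nat -> nat) k :
  (forall i, (i < k)%N -> (w i < M)%N) ->
  fine (P [set u | forall i, (i < k)%N -> madic_digit i u = w i]) = M%:R ^- k.
Proof.
move=> wM.
have Mk : (0 : R) < M%:R ^+ k by rewrite exprn_gt0.
set S := [set u | _].
rewrite -[P S]/(lebesgue_measure (S `&` `[(0:R), 1[)).
rewrite (_ : S `&` _ = `[(prefix_value w k)%:R / M%:R ^+ k, (prefix_value w k).+1%:R / M%:R ^+ k[%classic).
  rewrite lebesgue_measure_itv/= lte_fin ltr_pM2r ?invr_gt0// ltr_nat leqnn/=.
  by rewrite -mulrBl -natr1 addrC addKr mul1r.
apply/seteqP; split => u; rewrite /S /= !in_itv/= ler_pdivrMr// ltr_pdivlMr//.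
  move=> [H u01]; have /andP[u0 _] := u01.
  have [/(_ H) h _] := digits_prefixP u01 wM.
  by rewrite -truncn_eq ?h ?eqxx// mulr_ge0// ltW.
move=> /andP[h1 h2].
have u0 : 0 <= u.
  by rewrite -(pmulr_lge0 _ Mk) (le_trans _ h1).
have u1 : u < 1.
  rewrite -(ltr_pM2r Mk) mul1r (lt_le_trans h2)// -natrX ler_nat.
  exact: prefix_value_lt.
have u01 : 0 <= u < 1 by rewrite u0.
split => //; apply/(digits_prefixP u01 wM).
by apply: truncn_def; rewrite h1.
Qed.

(** All words of length [K], a bound on the positions involved, are equally likely. The constraint
    factors over the [K] positions, so the sum over words is a product of sums: a constrained
    position gives [M^-1], a free one gives 1. *)
Lemma prob_digits (p w : nat -> nat) k :
  (forall i j, (i < k)%N -> (j < k)%N -> p i = p j -> i = j) ->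
  (forall i, (i < k)%N -> (w i < M)%N) ->
  fine (P [set u | forall i, (i < k)%N -> madic_digit (p i) u = w i]) = M%:R ^- k.
Proof.
move=> pinj wM.
pose K := (\sum_(i < k) (p i).+1)%N.
have pK i : (i < k)%N -> (p i < K)%N.
  by move=> ik; rewrite /K (bigD1 (Ordinal ik))//= leq_addr.
pose A := {ffun 'I_K -> 'I_M}.
pose b (u : mR) : A := [ffun i : 'I_K => Ordinal (madic_digit_lt i u)].
have bE v : b @^-1` [set v] = [set u | forall i, (i < K)%N ->
    madic_digit i u = (if insub i is Some j then val (v j) else 0%N)].
  apply/seteqP; split => u /=.
    by move=> <- i iK; rewrite insubT/= ffunE.
  move=> H; apply/ffunP => i; rewrite ffunE; apply/val_inj => /=.
  by rewrite H//; case: insubP => [j _ /val_inj ->//|]; rewrite ltn_ord.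
have mb v : measurable (b @^-1` [set v]).
  by rewrite bE; exact: (measurable_digits id).
have pb v : fine (P (b @^-1` [set v])) = M%:R ^- K.
  rewrite bE prob_digits_prefix// => i iK; rewrite insubT; exact: ltn_ord.
set S := [set u | _]; have mS : measurable S by exact: measurable_digits.
rewrite (probability_sum_partition P (F := fun v => b @^-1` [set v]))//; last 2 first.
- by move=> i j _ _ [u [/= <- <-]].
- by move=> u _; exists (b u).
pose ok (v : A) := [forall i : 'I_k, v (Ordinal (pK i (ltn_ord i))) == w i :> nat].
have SbE v : fine (P (S `&` b @^-1` [set v])) =
    \prod_(j < K) (M%:R^-1 * ([forall i : 'I_k, (p i == j) ==> (val (v j) == w i)])%:R).
  have -> : \prod_(j < K) (M%:R^-1 * ([forall i : 'I_k, (p i == j) ==> (val (v j) == w i)])%:R) = M%:R ^- K * (ok v)%:R :> R.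
    rewrite big_split/= prodr_const card_ord exprVn; congr (_ * _).
    case: (boolP (ok v)) => [/forallP okv|].
      rewrite big1// => j _; rewrite (_ : [forall _, _] = true)//.
      apply/forallP => i; apply/implyP => /eqP pij; rewrite -(eqP (okv i)).
      by apply/eqP; congr (val (v _)); apply/val_inj.
    rewrite negb_forall => /existsP[i ni].
    rewrite (bigD1 (Ordinal (pK i (ltn_ord i))))//= (_ : [forall _, _] = false) ?mul0r//.
    apply/negbTE; rewrite negb_forall; apply/existsP; exists i.
    by rewrite negb_imply eqxx.
  case: (boolP (ok v)) => [/forallP okv|nok].
    rewrite mulr1 (_ : S `&` _ = b @^-1` [set v]) ?pb//.
    apply/seteqP; split => [u []//|u bu]; split => // i ik.
    by rewrite -(eqP (okv (Ordinal ik))) -bu ffunE.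
  rewrite mulr0 (_ : S `&` _ = set0) ?measure0//.
  rewrite -subset0 => u [Su bu]; move: nok => /negP; apply; apply/forallP => i.
  by rewrite -bu ffunE /= Su.
under eq_bigr do rewrite SbE.
rewrite -(bigA_distr_bigA (fun (j : 'I_K) (a : 'I_M) => M%:R^-1 * ([forall i : 'I_k, (p i == j) ==> (val a == w i)])%:R)).
pose p' (i : 'I_k) : 'I_K := Ordinal (pK i (ltn_ord i)).
have p'inj : injective p'.
  by move=> i j /(congr1 val) /= /pinj h; apply/val_inj/h.
rewrite (eq_bigr (fun j => if j \in codom p' then M%:R^-1 else 1)).
  rewrite -big_mkcond/= prodr_const exprVn.
  by rewrite card_codom// card_ord.
move=> j _; rewrite -mulr_sumr -natr_sum.
case: ifPn => [/codomP[i ->]|nj].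
  rewrite (bigD1 (Ordinal (wM i (ltn_ord i))))//= big1 ?addn0.
    rewrite (_ : [forall _, _] = true) ?mulr1//.
    apply/forallP => i'; apply/implyP => /eqP h.
    by rewrite (pinj i' i).
  move=> a ai; apply/eqP; rewrite eqb0 negb_forall; apply/existsP; exists i.
  by rewrite negb_imply eqxx/=; apply: contra ai => /eqP h; apply/eqP/val_inj.
rewrite (eq_bigr (fun=> 1%N)); last first.
  move=> a _; rewrite (_ : [forall _, _] = true)//; apply/forallP => i.
  apply/implyP => /eqP pij; move: nj => /negP; case; apply/codomP; exists i.
  exact/val_inj.
by rewrite sum_nat_const card_ord muln1 mulVf// pnatr_eq0.
Qed.

End digits.

Definition cylinder (w : nat -> nat) (k : nat) : set (nat -> nat) :=
  [set x | forall i, (i < k)%N -> x i = w i].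

(** The empty set is added for closure under intersection. *)
Definition cylinders : set (set (nat -> nat)) :=
  [set A | A = set0 \/ exists w k, A = cylinder w k].

Lemma cylinders_setI : setI_closed cylinders.
Proof.
move=> A B [->|[w [k ->]]]; first by rewrite set0I; left.
move=> [->|[w' [k' ->]]]; first by rewrite setI0; left.
have [->|/set0P[x [xw xw']]] := eqVneq (cylinder w k `&` cylinder w' k') set0.
  by left.
right; exists x, (maxn k k'); apply/seteqP; split => y.
  move=> [yw yw'] i; rewrite leq_max => /orP[ik|ik].
    by rewrite yw// xw.
  by rewrite yw'// xw'.
move=> H; split => i ik.
  by rewrite H ?xw// leq_max ik.
by rewrite H ?xw'// leq_max ik orbT.
Qed.

Section digit_law.
Context {R : realType}.
Variable m : nat.
Local Notation M := m.+1.
Local Notation mR := (measurableTypeR R).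
Local Notation P := (@unit_lebesgue R : probability mR R).
Local Notation DS := (g_sigma_algebraType cylinders).

Definition digit_seq (p : nat -> nat) (u : mR) : DS := fun k => madic_digit m (p k) u.

Lemma measurable_digit_seq p : measurable_fun setT (digit_seq p).
Proof.
apply: (@measurability _ _ mR DS setT (digit_seq p) cylinders erefl) => // _ [A cA <-].
rewrite setTI; case: cA => [->|[w [k ->]]]; first by rewrite preimage_set0.
exact: measurable_digits.
Qed.

(** By [prob_digits] both laws agree on cylinders, an intersection-stable generator. A word with a
    digit outside the alphabet has an empty preimage under both. *)
Lemma digit_seq_law p (A : set DS) : injective p -> measurable A ->
  P (digit_seq p @^-1` A) = P (digit_seq id @^-1` A).
Proof.
move=> pinj mA.
have [X XE] : exists X : {RV P >-> DS}, (X : mR -> DS) = digit_seq p.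
  by exists (mfun_Sub (mem_set (measurable_digit_seq p))).
have [X' XE'] : exists X : {RV P >-> DS}, (X : mR -> DS) = digit_seq id.
  by exists (mfun_Sub (mem_set (measurable_digit_seq id))).
rewrite -XE -XE' -[LHS]/(distribution P X A) -[RHS]/(distribution P X' A).
apply: (@measure_unique _ R DS cylinders (fun=> setT) erefl _ _ _
  (distribution P X) (distribution P X')) => //.
- exact: cylinders_setI.
- by move=> _; right; exists (fun=> 0%N), 0%N; apply/seteqP; split.
- by apply/seteqP; split => // x _; exists 0%N.
- move=> B [->|[w [k ->]]]; first by rewrite !measure0.
  rewrite /distribution /pushforward/= XE XE'.
  have [wM|] := pselect (forall i, (i < k)%N -> (w i < M)%N).
    have fin q : P (digit_seq q @^-1` cylinder w k) \is a fin_num.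
      by rewrite fin_num_measure//; exact: measurable_digits.
    have pE q : injective q -> P (digit_seq q @^-1` cylinder w k) = (M%:R ^- k)%:E.
      move=> qinj; rewrite -(fineK (fin q)); congr (_%:E).
      by apply: prob_digits => // i j _ _ /qinj.
    exact: (etrans (pE p pinj) (esym (pE id (fun _ _ => id)))).
  move=> /existsNP[i /not_implyP[ik wi]].
  have E q : digit_seq q @^-1` cylinder w k = set0.
    rewrite -subset0 => u /(_ i ik) h; apply: wi; rewrite -h.
    exact: madic_digit_lt.
  by rewrite !E.
- move=> _; rewrite (le_lt_trans (probability_le1 _ _)) ?ltry//.
Qed.

End digit_law.

(** * Trees of separated points *)

Section tree.
Context {R : realType} {X : pointedMetricType R}.
Hypothesis cX : compact [set: X].
Variables (lam delta : R) (M : nat).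
Hypotheses (lam0 : 0 < lam) (lam2 : lam <= 2^-1) (delta0 : 0 < delta).
Hypothesis branch : forall x t, 0 < t -> t <= delta -> exists p : nat -> X,
  (forall i, mdist x (p i) <= t / 2) /\
  (forall i j, (i < M)%N -> (j < M)%N -> i <> j -> 4 * lam * t < mdist (p i) (p j)).

Let radius_gt0 j : 0 < delta * lam ^+ j.
Proof. by rewrite mulr_gt0// exprn_gt0. Qed.

(** A node of level [j] has radius [delta * lam ^+ j]. Children lie within half of it and
    [lam <= 1/2], so all later displacements add up to at most the radius. Children are more than
    four times the next radius apart, and each limit is within that next radius of its child; so
    paths parting at level [i] have limits more than twice the radius of level [i.+1] apart. *)
Lemma tree_limit : exists f : X -> (nat -> nat) -> X,
  [/\ forall x w, mdist x (f x w) <= delta,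
      forall x w w' j, (forall i, (i < j)%N -> w i = w' i) ->
        mdist (f x w) (f x w') <= 2 * (delta * lam ^+ j) &
      forall x w w' j, (forall i, (w i < M)%N) -> (forall i, (w' i < M)%N) ->
        mdist (f x w) (f x w') <= 2 * (delta * lam ^+ j) ->
        forall i, (i < j)%N -> w i = w' i].
Proof.
have /choice[child childP] : forall xj : X * nat, exists p : nat -> X,
  (forall i, mdist xj.1 (p i) <= delta * lam ^+ xj.2 / 2) /\
  (forall i j, (i < M)%N -> (j < M)%N -> i <> j ->
    4 * lam * (delta * lam ^+ xj.2) < mdist (p i) (p j)).
  move=> [x j]; apply: branch => //=.
  by rewrite ger_pMr// exprn_ile1 ?(ltW lam0)// (le_trans lam2)// invf_le1// ler1n.
pose node x (w : nat -> nat) := fix node j :=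
  if j is j'.+1 then child (node j', j') (w j') else x.
have node_ext x w w' j : (forall i, (i < j)%N -> w i = w' i) -> node x w j = node x w' j.
  elim: j => //= j IH H; rewrite IH ?H// => i ij.
  by apply: H; rewrite ltnW.
have nodeD x w j n : mdist (node x w j) (node x w (j + n)%N) <=
    delta * lam ^+ j * (1 - 2^-1 ^+ n).
  elim: n => [|n IH]; first by rewrite addn0 mdistxx expr0 subrr mulr0.
  rewrite addnS; apply: le_trans (metric_triangle _ (node x w (j + n)%N) _) _.
  have [/(_ (w (j + n)%N)) h _] := childP (node x w (j + n)%N, (j + n)%N).
  apply: (le_trans (lerD IH h)) => /=.
  have : delta * lam ^+ (j + n) <= delta * lam ^+ j * 2^-1 ^+ n.
    rewrite exprD mulrA ler_pM2l//.
    by rewrite lerXn2r ?nnegrE ?invr_ge0// ltW.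
  rewrite exprS; set a := 2^-1 ^+ n; set b := delta * lam ^+ j; set q := delta * _; lra.
have /choice[f fP] : forall xw : X * (nat -> nat), exists p : X,
    forall j, mdist (node xw.1 xw.2 j) p <= delta * lam ^+ j.
  move=> [x w] /=.
  (* The path has a cluster point by compactness. From level [j] on its nodes stay within the radius
     of node [j], hence so does the cluster point. *)
  have [p [_ clp]] := cX (F := node x w @ \oo) _ filterT.
  exists p => j; apply/ler_addgt0Pr => e e0.
  have FA : (node x w @ \oo) [set y | mdist (node x w j) y <= delta * lam ^+ j].
    exists j => // n /= jn; rewrite -(subnKC jn).
    by apply: le_trans (nodeD _ _ _ _) _; rewrite ler_piMr ?(ltW (radius_gt0 j)).
  have [y [/= y1]] := clp _ _ FA (nbhsx_ballx p e e0).
  rewrite ballEmdist/= metric_sym => y2.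
  apply: le_trans (metric_triangle _ y _) _; rewrite lerD// ltW//.
exists (fun x w => f (x, w)); split.
- by move=> x w; have := fP (x, w) 0%N; rewrite expr0 mulr1.
- move=> x w w' j H; have h1 := fP (x, w) j; have h2 := fP (x, w') j.
  rewrite /= (node_ext x w w' j H) in h1 h2.
  have := metric_triangle (f (x, w)) (node x w' j) (f (x, w')).
  rewrite (metric_sym (f (x, w)) (node _ _ _)); lra.
move=> x w w' j wM wM' H; elim/ltn_ind => i IH ij.
have {}IH k : (k < i)%N -> w k = w' k by move=> ki; apply: IH => //; exact: ltn_trans ij.
apply: contrapT => ne.
have [_ sep] := childP (node x w i, i).
have := sep _ _ (wM i) (wM' i) ne => /=.
have h1 := fP (x, w) i.+1; have h2 := fP (x, w') i.+1.
rewrite /= -(node_ext x w w' i IH) in h1 h2.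
set a := child _ _ in h1 *; set b := child _ _ in h2 *.
have t1 := metric_triangle a (f (x, w)) b.
have t2 := metric_triangle (f (x, w)) (f (x, w')) b.
rewrite (metric_sym (f (x, w')) b) in t2.
have : delta * lam ^+ j <= delta * lam ^+ i.+1.
  rewrite ler_pM2l// ler_wiXn2l ?(ltW lam0)//.
  by rewrite (le_trans lam2)// invf_le1// ler1n.
rewrite exprS in h1 h2 *.
set q := lam ^+ i in h1 h2 *; set z := delta * lam ^+ j in H *.
lra.
Qed.

End tree.

Section branching.
Context {R : realType} {X : pointedMetricType R}.
Variables (rho : probability (g_sigma_algebraType (@open X)) R) (s c r0 : R).
Hypothesis c1 : 1 <= c.
Hypothesis reg : forall (x : X) (r : R), 0 < r -> r <= r0 ->
  ((c^-1 * r `^ s)%:E <= rho (metric_closed_ball mdist x r)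
        <= (c * r `^ s)%:E)%E.

(** Regularity gives at least [c ^- 2 * (8 * lam) ^ (- s)] children, since [t / 2] divided by
    [4 * lam * t] is [1 / (8 * lam)]. A small [lam] makes the logarithm of [c ^+ 2 * 8 ^ s] at most
    [eta * - ln lam]. *)
Lemma branching_ratio (eta : R) : 0 < eta -> exists (lam : R) (m : nat),
  [/\ 0 < lam, lam <= 2^-1,
      (s - eta) * - ln lam <= ln m.+1%:R &
      forall x t, 0 < t -> t <= r0 -> exists p : nat -> X,
       (forall i, mdist x (p i) <= t / 2) /\
       (forall i j, (i < m.+1)%N -> (j < m.+1)%N -> i <> j -> 4 * lam * t < mdist (p i) (p j))].
Proof.
move=> eta0; have c0 : 0 < c by exact: lt_le_trans c1.
have [lam [lam0 lam4 lamB]] : exists lam : R, [/\ 0 < lam, lam <= 4^-1 &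
    (ln (c ^+ 2) + s * ln 8) / eta <= - ln lam].
  have : \forall e \near (0:R)^'+, [/\ 0 < e, e <= 4^-1 &
    (ln (c ^+ 2) + s * ln 8) / eta <= - ln e].
    near=> e; split; [by []| |by near: e; exact: near0_ln_ge].
    by near: e; apply: nbhs_right_le; rewrite invr_gt0.
  by move=> /filter_ex.
have q0 : 0 < (1 / (8 * lam)) `^ s by rewrite powR_gt0// divr_gt0// mulr_gt0.
have A0 : 0 < c ^- 2 * (1 / (8 * lam)) `^ s by rewrite mulr_gt0// invr_gt0 exprn_gt0.
have [k [kge kmin]] := nat_ceil (c ^- 2 * (1 / (8 * lam)) `^ s).
have k0 : (0 < k)%N by rewrite -(ltr0n R) (lt_le_trans A0).
exists lam, k.-1; rewrite prednK//; split => //.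
- by rewrite (le_trans lam4)// lef_pV2 ?posrE// ler_nat.
- have : ln (c ^- 2 * (1 / (8 * lam)) `^ s) <= ln (k%:R : R).
    by rewrite ler_ln ?posrE// ltr0n.
  rewrite lnM ?posrE ?invr_gt0 ?exprn_gt0//.
  rewrite lnV ?posrE ?exprn_gt0// ln_powR div1r lnV ?posrE ?mulr_gt0//.
  rewrite lnM ?posrE//.
  move: lamB; rewrite ler_pdivrMr//; lra.
- move=> x t t0 tr0.
  have t20 : 0 < t / 2 by rewrite divr_gt0.
  have r0' : 0 < 4 * lam * t by rewrite !mulr_gt0.
  have tr2 : t / 2 <= r0 by lra.
  have lr : 4 * lam * t <= r0.
    apply: le_trans tr0; rewrite ler_piMl ?(ltW t0)//; lra.
  have [l [sl lx ls]] := many_separated c1 reg x t20 tr2 r0' lr.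
  have ratio : t / 2 / (4 * lam * t) = 1 / (8 * lam).
    by field; rewrite !gt_eqF.
  rewrite ratio in ls; have {}ls := kmin _ ls.
  (* Out of range [nth] returns the centre [x], so the first clause holds at every index. *)
  exists (nth x l); split => [i|i j ik jk ij].
    have [il|il] := ltnP i (size l); first by rewrite lx// mem_nth.
    by rewrite nth_default// mdistxx ltW.
  have {}ik := leq_trans ik ls; have {}jk := leq_trans jk ls.
  have /(pairwiseP x) sp := sl.
  have [h|h|//] := ltngtP i j; first by apply: sp.
  by rewrite metric_sym; apply: sp.
Unshelve. all: by end_near. Qed.

End branching.

(** * Invariant laws carried by tubes around periodic orbits *)

(* Digit [i] of coordinate [n] sits at the position [k] with
   [k.+1 = 2 ^ n * (2 * i + 1)], so that shifting the coordinates by one is the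
   injective renumbering [k |-> 2 * k + 1] of the digits. *)
Definition digit_index (n i : nat) : nat := (2 ^ n * i.*2.+1).-1.

Lemma digit_indexK n i : (digit_index n i).+1 = (2 ^ n * i.*2.+1)%N.
Proof. by rewrite /digit_index prednK// muln_gt0 expn_gt0. Qed.

Lemma digit_indexS n i : digit_index n.+1 i = (digit_index n i).*2.+1.
Proof.
apply: succn_inj; rewrite digit_indexK -doubleS digit_indexK expnS.
by rewrite -[RHS]mul2n mulnA.
Qed.

Lemma digit_index_inj n i n' i' : digit_index n i = digit_index n' i' -> n = n' /\ i = i'.
Proof.
elim: n n' => [|n IH] [|n'].
- rewrite /digit_index !expn0 !mul1n/= => /(congr1 half).
  by rewrite !doubleK.
- rewrite digit_indexS /digit_index expn0 mul1n/= => /(congr1 odd).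
  by rewrite /= !odd_double.
- rewrite digit_indexS /digit_index expn0 mul1n/= => /(congr1 odd).
  by rewrite /= !odd_double.
- rewrite !digit_indexS => -[] /(congr1 half); rewrite !doubleK => /IH[-> ->].
  by [].
Qed.

Section mixture.
Context d (T : measurableType d) (R : realType).
Variables (nu : nat -> probability T R) (N : nat).

(* The index is shifted: the average is over the [N.+1] laws [nu 0], ..., [nu N]. *)
Definition mixture : set T -> \bar R :=
  mscale (N.+1%:R^-1)%:nng (msum nu N.+1).

HB.instance Definition _ := Measure.on mixture.

Lemma mixtureE A : mixture A = ((N.+1%:R^-1)%:E * \sum_(j < N.+1) nu j A)%E.
Proof. by []. Qed.

Let mixtureT : mixture setT = 1%E.
Proof.
rewrite mixtureE (eq_bigr (fun=> 1%:E)); last by move=> j _; exact: probability_setT.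
by rewrite sumEFin -EFinM sumr_const card_ord mulVf.
Qed.

HB.instance Definition _ := Measure_isProbability.Build _ _ _ mixture mixtureT.

End mixture.

Section process.
Context {R : realType} {X : pointedMetricType R}.
Variable D : R.
Hypothesis mD : forall a b : X, mdist a b <= D.
Variables (f : X -> (nat -> nat) -> X) (delta lam : R) (m : nat).
Hypotheses (lam0 : 0 < lam) (lam2 : lam <= 2^-1) (delta0 : 0 < delta).
Hypothesis f_center : forall x w, mdist x (f x w) <= delta.
Hypothesis f_prefix : forall x w w' j, (forall i, (i < j)%N -> w i = w' i) ->
  mdist (f x w) (f x w') <= 2 * (delta * lam ^+ j).
Hypothesis f_separated : forall x w w' j,
  (forall i, (w i < m.+1)%N) -> (forall i, (w' i < m.+1)%N) ->
  mdist (f x w) (f x w') <= 2 * (delta * lam ^+ j) ->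
  forall i, (i < j)%N -> w i = w' i.
Local Notation T := (@left_shift R X).
Local Notation sd := (@seq_dist R X).
Local Notation Om := (borel sd).
Local Notation DS := (g_sigma_algebraType cylinders).
Local Notation mR := (measurableTypeR R).
Local Notation P := (@unit_lebesgue R : probability mR R).

Definition tree_seq (xt : nat -> X) (w : DS) : Om :=
  fun n => f (xt n) (fun i => w (digit_index n i)).

Lemma tree_seq_shift xt w :
  T (tree_seq xt w) = tree_seq (T xt) (fun k => w k.*2.+1).
Proof.
by apply/funext => n; rewrite /tree_seq /left_shift; congr f; apply/funext => i; rewrite digit_indexS.
Qed.

Lemma tree_seq_continuous xt (w : nat -> nat) (e : R) : 0 < e ->
  exists k, forall w', cylinder w k w' -> sd (tree_seq xt w) (tree_seq xt w') < e.
Proof.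
move=> e0.
have [j jP] : exists j, 4 * (delta * lam ^+ j) < e / 2.
  have : lam ^+ n @[n --> \oo] --> (0 : R).
    by apply: cvg_expr; rewrite ger0_norm ?(ltW lam0)// (le_lt_trans lam2)// invf_lt1// ltr1n.
  move/cvgrPdist_lt => /(_ (e / 2 / (4 * delta))).
  rewrite !divr_gt0 ?mulr_gt0// => /(_ isT)[j _ /(_ j (leqnn j))].
  rewrite sub0r normrN ger0_norm ?exprn_ge0 ?(ltW lam0)//.
  by rewrite ltr_pdivlMr ?mulr_gt0// => h; exists j; lra.
have e40 : 0 < e / 4 by rewrite divr_gt0.
have [n nP] := exists_geometric_le (2 * D) e40.
(* A crude upper bound for all positions holding the first [j] digits of the first [n]
   coordinates. *)
exists (\sum_(a < n) \sum_(i < j) (digit_index a i).+1)%N => w' ww'.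
apply: (@le_lt_trans _ _ (2 * (2 * (delta * lam ^+ j)) + 2 ^- n * (2 * D))); last lra.
apply: (seq_dist_le_prefix mD).
  by rewrite !mulr_ge0 ?exprn_ge0 ?(ltW lam0) ?(ltW delta0).
move=> a an; apply: f_prefix => i ij; apply/esym/ww'.
by rewrite (bigD1 (Ordinal an))//= (bigD1 (Ordinal ij))//= -addnA leq_addr.
Qed.

Lemma measurable_tree_seq xt : measurable_fun setT (tree_seq xt).
Proof.
apply: (@measurability _ _ DS Om setT _ (open_for sd) erefl) => // _ [A oA <-].
rewrite setTI.
(* By [tree_seq_continuous] the preimage of an open set is a union of cylinders; coding them by
   finite words makes the union countable. *)
pose B (n : nat) : set DS := if @unpickle (seq nat) n is Some w then
  [set v | cylinder (nth 0%N w) (size w) v /\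
     cylinder (nth 0%N w) (size w) `<=` tree_seq xt @^-1` A] else set0.
rewrite (_ : _ @^-1` _ = \bigcup_n B n).
  apply: bigcupT_measurable => n; rewrite /B; case: unpickle => // w.
  have [h|h] := pselect (cylinder (nth 0%N w) (size w) `<=` tree_seq xt @^-1` A).
    rewrite (_ : [set v | _] = cylinder (nth 0%N w) (size w)).
      by apply: sub_sigma_algebra; right; exists (nth 0%N w), (size w).
    by apply/seteqP; split => [v []|v cv].
  by rewrite (_ : [set v | _] = set0)// -subset0 => v [_ /h].
apply/seteqP; split => [w Aw|w [n _]].
  have [e e0 eA] := oA _ Aw; have [k kP] := tree_seq_continuous xt w e0.
  have cE v : cylinder (nth 0%N (mkseq w k)) (size (mkseq w k)) v <-> cylinder w k v.
    rewrite size_mkseq; split => H i ik; rewrite H// nth_mkseq//.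
  exists (pickle (mkseq w k)) => //; rewrite /B pickleK; split; first exact/cE.
  by move=> v /cE vk; apply: eA; exact: kP.
by rewrite /B; case: unpickle => // v [wv]; exact.
Qed.

Definition tree_process xt : mR -> Om := tree_seq xt \o @digit_seq R m id.

Lemma measurable_tree_process xt : measurable_fun setT (tree_process xt).
Proof.
apply: measurableT_comp; first exact: measurable_tree_seq.
exact: measurable_digit_seq.
Qed.

HB.instance Definition _ xt := isMeasurableFun.Build _ _ mR Om (tree_process xt)
  (measurable_tree_process xt).

Definition tree_law xt : probability Om R := distribution P (tree_process xt).

(** After the shift the digits are read along [k.*2.+1], which is injective, so [digit_seq_law]
    applies. *)
Lemma tree_law_shift xt (A : set Om) : measurable A ->
  tree_law xt (T @^-1` A) = tree_law (T xt) A.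
Proof.
move=> mA; rewrite /tree_law /distribution /pushforward/=.
have pinj : injective (fun k => k.*2.+1) by move=> i j [] /double_inj.
have mB : measurable (tree_seq (T xt) @^-1` A).
  by rewrite -[X in measurable X]setTI; apply: measurable_tree_seq.
rewrite -[RHS]/(P (@digit_seq R m id @^-1` (tree_seq (T xt) @^-1` A))).
rewrite -(digit_seq_law m pinj mB); congr (P _).
by apply/seteqP; split => u; rewrite /preimage/= tree_seq_shift.
Qed.

(** Fix one sample [u0] in the cell. Any other sample there has its first [n] coordinates within
    [2 * e] of those of [u0], so [f_separated] forces the first [j] digits of each to agree: [n * j]
    digits at distinct positions are prescribed. *)
Lemma tree_law_cells xt (l : seq X) (e : R) (n j : nat) (w : 'I_n -> nat) :
  (forall z, exists2 y, y \in l & mdist y z <= e) -> e <= delta * lam ^+ j ->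
  (tree_law xt [set x : Om | forall k : 'I_n, quantize l e (x k) = w k] <=
    (m.+1%:R ^- (n * j))%:E)%E.
Proof.
move=> lnet ej; rewrite /tree_law /distribution /pushforward/=.
set S := [set x | _]; set pS := _ @^-1` S.
have mS : measurable S by exact: (measurable_cells mD).
have mpS : measurable pS.
  by rewrite /pS -[X in measurable X]setTI; apply: measurable_tree_process.
have [->|/set0P[u0 Su0]] := eqVneq pS set0.
  by rewrite measure0 lee_fin invr_ge0 exprn_ge0.
(* [t] enumerates the pairs of a coordinate [t %/ j] and a digit [t %% j]. *)
pose p t := digit_index (t %/ j) (t %% j).
pose V := [set u : mR | forall t, (t < n * j)%N -> madic_digit m (p t) u = madic_digit m (p t) u0].
have mV : measurable V by exact: measurable_digits.
have sub : pS `<=` V.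
  move=> u Su t tnj /=.
  have j0 : (0 < j)%N by rewrite lt0n; apply: contraTneq tnj => ->; rewrite muln0.
  have kn : (t %/ j < n)%N by rewrite ltn_divLR.
  have ij : (t %% j < j)%N by rewrite ltn_pmod.
  have h1 := Su (Ordinal kn); have h2 := Su0 (Ordinal kn).
  have [_ q1] := quantizeP (lnet (tree_process xt u (t %/ j)%N)).
  have [_ q2] := quantizeP (lnet (tree_process xt u0 (t %/ j)%N)).
  rewrite /= in h1 h2; rewrite h1 in q1; rewrite h2 in q2.
  apply: (@f_separated (xt (t %/ j)%N) (fun i => madic_digit m (digit_index (t %/ j) i) u)
    (fun i => madic_digit m (digit_index (t %/ j) i) u0) j _ _ _ _ ij).
  - by move=> i; exact: madic_digit_lt.
  - by move=> i; exact: madic_digit_lt.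
  set y := nth _ _ _ in q1 q2.
  have := metric_triangle (tree_process xt u (t %/ j)%N) y (tree_process xt u0 (t %/ j)%N).
  rewrite (metric_sym _ y); rewrite /tree_process/= /tree_seq/digit_seq/= in q1 q2 *; lra.
apply: (@le_trans _ _ (P V)).
  by apply: le_measure; rewrite ?inE.
have fin : P V \is a fin_num by rewrite fin_num_measure.
rewrite -(fineK fin) lee_fin prob_digits//.
- move=> t t' _ _ /digit_index_inj[h1 h2].
  by rewrite (divn_eq t j) h1 h2 -divn_eq.
- by move=> i _; exact: madic_digit_lt.
Qed.

Variables (xt : nat -> X) (N : nat).
Hypothesis xt_periodic : forall n, xt (n + N.+1)%N = xt n.

Definition periodic_law : probability Om R := mixture (fun j => tree_law (iter j T xt)) N.

Lemma periodic_law_invariant : invariant_measure T periodic_law.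
Proof.
move=> A mA; rewrite /periodic_law /= !mixtureE; congr (_ * _)%E.
rewrite (eq_bigr (fun j : 'I_N.+1 => tree_law (iter j.+1 T xt) A)); last first.
  by move=> j _; rewrite tree_law_shift.
(* The shift sends phase [j] to phase [j.+1], and periodicity returns the last one to phase 0. *)
rewrite big_ord_recr [RHS]big_ord_recl addeC; congr (_ + _)%E.
congr (tree_law _ A); apply/funext => n.
by rewrite iter_shift xt_periodic.
Qed.

Lemma periodic_law_cells (l : seq X) (e : R) (n j : nat) (w : 'I_n -> nat) :
  (forall z, exists2 y, y \in l & mdist y z <= e) -> e <= delta * lam ^+ j ->
  (periodic_law [set x : Om | forall k : 'I_n, quantize l e (x k) = w k] <=
    (m.+1%:R ^- (n * j))%:E)%E.
Proof.
move=> lnet ej; rewrite /periodic_law /= mixtureE.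
rewrite lee_pdivrMl// -EFinM.
apply: (@le_trans _ _ (\sum_(i < N.+1) (m.+1%:R ^- (n * j))%:E)%E).
  by apply: lee_sum => i _; exact: tree_law_cells.
by rewrite sumEFin sumr_const card_ord mulr_natl.
Qed.

Lemma periodic_law_eq0 (A : set Om) :
  (forall j x, (forall n, mdist (iter j T xt n) (x n) <= delta) -> ~ A x) ->
  periodic_law A = 0%E.
Proof.
move=> H; rewrite /periodic_law /= mixtureE big1 ?mule0// => j _.
rewrite /tree_law /distribution /pushforward/= (_ : _ @^-1` A = set0) ?measure0//.
rewrite -subset0 => u /=; apply: H => n; exact: f_center.
Qed.

End process.

(** * Near-optimal invariant measures *)

(** Read [x] as [- ln e], [lM] as the logarithm of the branching number, [k] as [kappa^-1], [lK] as
    the logarithm of the net size, [y] as the real depth of the tree at scale [e] and [j] as its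
    integer part. *)
Lemma rate_gap_arith (R : realType) (s eta eta' x ld lM l2B k l2 lK A y j : R) :
  y * lM <= (j + 1) * lM -> (s - eta) * (x + ld) <= y * lM ->
  k * (l2 + lK) <= k * (l2 + (A + s * x)) -> k * s * x <= eta * x ->
  - ((s - eta) * ld) + lM + l2B + k * (l2 + A) <= x * eta' ->
  (s - eta *+ 2 - eta') * x <= j * lM - l2B - k * (l2 + lK).
Proof. rewrite mulr2n; lra. Qed.

Section near_optimal_measure.
Context {R : realType} {X : pointedMetricType R}.
Hypothesis cX : compact [set: X].
Variables (rho : probability (g_sigma_algebraType (@open X)) R) (s c r0 : R).
Hypotheses (s0 : 0 <= s) (c1 : 1 <= c) (r00 : 0 < r0).
Hypothesis reg : forall (x : X) (r : R), 0 < r -> r <= r0 ->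
  ((c^-1 * r `^ s)%:E <= rho (metric_closed_ball mdist x r)
        <= (c * r `^ s)%:E)%E.
Variable D : R.
Hypothesis mD : forall a b : X, mdist a b <= D.
Local Notation T := (@left_shift R X).
Local Notation sd := (@seq_dist R X).
Local Notation Om := (borel sd).

(** One [eta] is lost in the branching ratio, the other to far coordinates in [rate_distortion_ge].
    The remaining losses, collected in [C], do not depend on [e]. *)
Lemma lower_rdim_ge (mu : probability Om R) (delta lam eta : R) (m : nat) :
  0 < delta -> 0 < lam -> lam < 1 -> 0 < eta ->
  (s - eta) * - ln lam <= ln m.+1%:R ->
  (forall (l : seq X) (e : R) (n j : nat) (w : 'I_n -> nat),
    (forall z, exists2 y, y \in l & mdist y z <= e) -> e <= delta * lam ^+ j ->
    (mu [set x : Om | forall k : 'I_n, quantize l e (x k) = w k] <=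
      (m.+1%:R ^- (n * j))%:E)%E) ->
  ((s - eta *+ 2)%:E <= lower_rdim T mu)%E.
Proof.
move=> delta0 lam0 lam1 eta0 lnm cells.
have [A netA] := ln_covering_net c1 reg.
(* The net has logarithmic size about [s * - ln e], so this choice keeps the loss from far
   coordinates below [eta * - ln e]; the [+ 1] keeps [kappa] positive when [s = 0]. *)
pose kappa := (s + 1) / eta.
have kappa0 : 0 < kappa by rewrite divr_gt0// ltr_wpDl.
have skappa : kappa^-1 * s <= eta.
  rewrite /kappa invf_div mulrAC ler_pdivrMr ?ltr_wpDl//.
  by rewrite ler_wpM2l ?(ltW eta0)// lerDl.
have c0 : 0 < c by exact: lt_le_trans c1.
have [Bc [Bcge _]] := nat_ceil (c ^+ 2 * (2 * (kappa + 2) + 1) `^ s).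
have Bc0 : (0 < Bc)%N.
  rewrite -(ltr0n R) (lt_le_trans _ Bcge)// mulr_gt0 ?exprn_gt0// powR_gt0//; lra.
have lnlam : 0 < - ln lam by rewrite oppr_gt0 ln_lt0// lam0.
have lnM0 : 0 <= ln m.+1%:R :> R by rewrite ln_ge0// ler1n.
pose C := - ((s - eta) * ln delta) + ln m.+1%:R + ln (2 * Bc%:R) + kappa^-1 * (ln 2 + A).
apply: limf_einf_ge => eta' eta'0.
near=> e.
have e0 : 0 < e by [].
have e1 : e < 1 by near: e; exact: nbhs_right_lt.
have ed : e <= delta by near: e; exact: nbhs_right_le.
have er : e <= r0 by near: e; exact: nbhs_right_le.
have ek : e <= r0 / (kappa + 3).
  by near: e; apply: nbhs_right_le; rewrite divr_gt0// ltr_wpDl// ltW.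
have lne : 0 < - ln e by rewrite oppr_gt0 ln_lt0// e0.
have Ce : C / eta' <= - ln e by near: e; exact: near0_ln_ge.
have [l [sl lz ls]] := netA _ e0 er.
(* The real solution of [e = delta * lam ^ y]; its integer part [j] is the depth at which cells of
   size [e] still determine the digits. *)
pose y := (- ln e + ln delta) / - ln lam.
have y0 : 0 <= y.
  rewrite divr_ge0 ?(ltW lnlam)// addrC subr_ge0.
  by rewrite ler_ln ?posrE.
pose j := Num.truncn y.
have /andP[jy yj] := truncn_itv y0.
have ej : e <= delta * lam ^+ j.
  rewrite -ler_ln ?posrE ?mulr_gt0 ?exprn_gt0// lnM ?posrE ?exprn_gt0// lnXn//.
  rewrite -mulr_natr; move: jy; rewrite -/j /y ler_pdivlMr//; lra.
pose E := j%:R * ln (m.+1%:R : R).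
have muE n (w : 'I_n -> nat) :
  (mu [set x : Om | forall k : 'I_n, quantize l e (x k) = w k] <= (expR (- (n%:R * E)))%:E)%E.
  apply: le_trans (cells _ _ _ _ w lz ej) _; rewrite lee_fin.
  rewrite /E mulrA -natrM expRN expRM_natl lnK ?posrE//.
have lcount y' : (count (fun z => (mdist y' z <= (kappa + 2) * e)%R) l <= Bc)%N.
  rewrite -(ler_nat R) (le_trans _ Bcge)//.
  apply: (separated_local_count c1 reg) => //; first by rewrite addr_ge0// ltW.
  move: ek; rewrite ler_pdivlMr; last by rewrite ltr_wpDl// ltW.
  by rewrite mulrC (_ : kappa + 2 + 1 = kappa + 3)//; ring.
have K0 : (0 : R) < (size l)%:R.
  by rewrite ltr0n; have [z] := lz point; case: l {sl lz ls muE lcount}.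
have main := rate_distortion_ge mD e0 kappa0 Bc0 lz lcount muE.
have lnE : `|ln e| = - ln e by rewrite ler0_norm// ltW// -oppr_gt0.
apply: le_trans (lee_wpmul2r _ main); last by rewrite lee_fin invr_ge0.
rewrite -EFinM lee_fin lnE ler_pdivlMr//.
rewrite [ln (2 * (size l)%:R)]lnM ?posrE//.
apply: (rate_gap_arith (s := s) (ld := ln delta) (A := A) (y := y)).
- by rewrite ler_wpM2r// natr1 ltW.
- have h : y * ((s - eta) * - ln lam) = (s - eta) * (- ln e + ln delta).
    by rewrite /y mulrCA divfK// gt_eqF.
  by rewrite -h ler_wpM2l.
- by rewrite ler_wpM2l ?invr_ge0 ?(ltW kappa0)// lerD2l.
- by rewrite ler_wpM2r// ltW.
- by move: Ce; rewrite ler_pdivrMr.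
Unshelve. all: by end_near. Qed.

Variables (phi : (nat -> X) -> R) (M beta : R).
Hypothesis phiM : forall x, `|phi x| <= M.
Hypothesis phi_two : depends_on_first_two phi.
Hypothesis mphi : measurable_fun setT (phi : Om -> R).
Hypothesis phi_unif : forall eta : R, 0 < eta -> exists t : R, [/\ 0 < t, t <= r0 &
  forall x y, (forall n, mdist (x n) (y n) <= t) -> `|phi x - phi y| <= eta].
Hypothesis beta_ge : forall N eta, 0 < eta ->
  exists x, N%:R * (beta - eta) <= birkhoff_sum T phi N x.
Local Notation S := (birkhoff_sum T phi).

(** For [i < N] the coordinates [i] and [i.+1] lie inside the period, so by [phi_two] the terms
    agree. Only the last term reads across the seam, and it changes by at most [2 * M]. *)
Lemma birkhoff_sum_periodize (x : nat -> X) N :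
  S N.+1 x - M *+ 2 <= S N.+1 (fun n => x (n %% N.+1)%N).
Proof.
rewrite /birkhoff_sum !big_ord_recr/=.
have -> : \sum_(i < N) phi (iter i T (fun n => x (n %% N.+1)%N)) =
  \sum_(i < N) phi (iter i T x).
  apply: eq_bigr => i _; apply: phi_two; rewrite !iter_shift modn_small//.
    by rewrite add0n ltnS ltnW.
  by rewrite add1n ltnS.
have := phiM (iter N T x); rewrite ler_norml => /andP[_].
have := phiM (iter N T (fun n => x (n %% N.+1)%N)); rewrite ler_norml => /andP[].
rewrite mulr2n; lra.
Qed.

(** Splitting the sum of length [N + 1] after its first or before its last term leaves the same
    single term, as [iter N T z = z]; the rests agree. *)
Lemma birkhoff_sum_periodic (x : nat -> X) N j :
  (forall n, x (n + N)%N = x n) -> S N (iter j T x) = S N x.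
Proof.
move=> xN; elim: j => //= j <-; set z := iter j T x.
have zN : iter N T z = z.
  by apply/funext => n; rewrite iter_shift /z !iter_shift -addnA (addnC N) addnA xN.
have := birkhoff_sumD T phi 1 N z; have := birkhoff_sumD T phi N 1 z.
rewrite zN addnC => ->; rewrite addrC => /addrI; exact: esym.
Qed.

Lemma birkhoff_sum_close (x y : nat -> X) N (t w : R) :
  (forall x y, (forall n, mdist (x n) (y n) <= t) -> `|phi x - phi y| <= w) ->
  (forall n, mdist (x n) (y n) <= t) -> S N x - N%:R * w <= S N y.
Proof.
move=> H xy; rewrite lerBlDr.
have -> : N%:R * w = \sum_(i < N) w by rewrite sumr_const card_ord mulr_natl.
rewrite -lerBlDl -sumrB; apply: ler_sum => i _; apply: le_trans (ler_norm _) _.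
by apply: H => k; rewrite !iter_shift.
Qed.

(** Budget in quarters of [eta]. The integral loses one to the choice of [x], one to the oscillation
    of [phi] over the tube of radius [t], one to periodizing; the dimension loses one to branching
    and one to far coordinates. *)
Lemma near_optimal_measure (eta : R) : 0 < eta -> exists mu : probability Om R,
  [/\ invariant_measure T mu, ((s - eta)%:E <= lower_rdim T mu)%E &
      ((beta - eta)%:E <= \int[mu]_x (phi x)%:E)%E].
Proof.
move=> eta0; have eta40 : 0 < eta / 4 by rewrite divr_gt0.
have [t [t0 tr0 phit]] := phi_unif eta40.
have [lam [m [lam0 lam2 lnm branch]]] := branching_ratio c1 reg eta40.
have branch' x u : 0 < u -> u <= t -> exists p : nat -> X,
       (forall i, mdist x (p i) <= u / 2) /\
       (forall i j, (i < m.+1)%N -> (j < m.+1)%N -> i <> j -> 4 * lam * u < mdist (p i) (p j)).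
  by move=> u0 ut; apply: branch => //; exact: le_trans tr0.
have [f [fc fp fs]] := tree_limit cX lam0 lam2 t0 branch'.
(* Spread over a period this long, the seam costs at most [eta / 4] per step. *)
have [N [NP _]] := nat_ceil (M *+ 2 / (eta / 4)).
have [x xb] := beta_ge N.+1 eta40.
pose xt n := x (n %% N.+1)%N.
have xtN n : xt (n + N.+1)%N = xt n by rewrite /xt modnDr.
pose mu : probability Om R := periodic_law mD m lam0 lam2 t0 fp xt N.
exists mu.
have mu_inv : invariant_measure T mu by exact: periodic_law_invariant.
split => //.
- apply: le_trans (_ : (s - eta / 4 *+ 2)%:E <= _)%E.
    by rewrite lee_fin mulr2n; lra.
  apply: (@lower_rdim_ge mu t lam (eta / 4) m) => //.
    by rewrite (le_lt_trans lam2)// invf_lt1// ltr1n.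
  by move=> l e n j w; exact: (periodic_law_cells mD lam0 lam2 t0 fp fs).
- apply: (integral_potential_ge mD mu_inv phiM mphi (N := N.+1)) => //.
  apply: (periodic_law_eq0 mD m lam0 lam2 t0 fc fp) => j y yt /=.
  apply/negP; rewrite -leNgt.
  have h1 := birkhoff_sum_close N.+1 phit yt.
  rewrite birkhoff_sum_periodic// in h1.
  have h2 := birkhoff_sum_periodize x N.
  have h3 : M *+ 2 <= N.+1%:R * (eta / 4).
    rewrite -ler_pdivrMr// (le_trans NP)// ler_nat//.
  rewrite -/xt in h2.
  have h4 : (0 : R) < N.+1%:R * eta by rewrite mulr_gt0.
  lra.
Qed.

End near_optimal_measure.

(** * Hoelder potentials on Ahlfors regular spaces *)

Section holder.
Context {R : realType} {X : pointedMetricType R}.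
Variable D : R.
Hypothesis mD : forall a b : X, mdist a b <= D.
Local Notation sd := (@seq_dist R X).
Variable phi : (nat -> X) -> R.
Hypothesis hphi : holder_continuous sd phi.

Lemma holder_bounded : exists M, forall x, `|phi x| <= M.
Proof.
have [C [a [/andP[a0 _] H]]] := hphi.
have D0 : 0 <= D by exact: le_trans (mdist_ge0 _ _) (mD point point).
exists (`|phi point| + `|C| * (2 * D) `^ a) => x.
rewrite -lerBlDl; apply: le_trans (lerB_dist _ _) _.
apply: (le_trans (H _ _)); apply: (@le_trans _ _ (`|C| * sd x point `^ a)).
  by rewrite ler_wpM2r ?powR_ge0// ler_norm.
rewrite ler_wpM2l// ge0_ler_powR ?nnegrE ?(ltW a0) ?mulr_ge0 ?(seq_dist_ge0 mD)//.
by apply: (seq_dist_le mD) => n; exact: mD.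
Qed.

Lemma holder_uniform (eta : R) : 0 < eta ->
  exists2 e : R, 0 < e & forall x y, sd x y <= e -> `|phi x - phi y| <= eta.
Proof.
move=> eta0; have [C [a [/andP[a0 _] H]]] := hphi.
have q0 : 0 < eta / (`|C| + 1) by rewrite divr_gt0// ltr_wpDl.
exists ((eta / (`|C| + 1)) `^ a^-1) => [|x y xy]; first by rewrite powR_gt0.
apply: (le_trans (H _ _)).
have h : sd x y `^ a <= eta / (`|C| + 1).
  set q := eta / _ in q0 xy *.
  have -> : q = (q `^ a^-1) `^ a by rewrite -powRrM mulVf ?lt0r_neq0// powRr1// ltW.
  by rewrite ge0_ler_powR ?nnegrE ?(ltW a0) ?powR_ge0 ?(seq_dist_ge0 mD).
apply: (@le_trans _ _ ((`|C| + 1) * sd x y `^ a)).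
  by rewrite ler_wpM2r ?powR_ge0// (le_trans (ler_norm _))// lerDl.
by rewrite -ler_pdivlMl ?ltr_wpDl// mulrC.
Qed.

Lemma measurable_holder : measurable_fun setT (phi : borel sd -> R).
Proof.
apply: (@measurability _ _ (borel sd) (measurableTypeR R) setT phi _ (RGenOInfty.measurableE R)).
move=> _ [_ [a ->] <-]; rewrite setTI; apply: sub_sigma_algebra => x /=.
rewrite in_itv/= andbT => ax.
have g0 : 0 < (phi x - a) / 2 by rewrite divr_gt0// subr_gt0.
have [e e0 eP] := holder_uniform g0.
exists e => // y /ltW/eP; rewrite ler_norml => /andP[_ h].
rewrite /= in_itv/= andbT; lra.
Qed.

Lemma holder_uniform_coordinates (r0 eta : R) : 0 < r0 -> 0 < eta ->
  exists t : R, [/\ 0 < t, t <= r0 & forall x y,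
    (forall n, mdist (x n) (y n) <= t) -> `|phi x - phi y| <= eta].
Proof.
move=> r00 /holder_uniform[e e0 eP]; exists (Num.min r0 (e / 2)); split.
- by rewrite lt_min r00 divr_gt0.
- by rewrite ge_min lexx.
- move=> x y xy; apply: eP; apply: le_trans (seq_dist_le mD xy) _.
  have : Num.min r0 (e / 2) <= e / 2 by rewrite ge_min lexx orbT.
  lra.
Qed.

End holder.

Section ahlfors.
Context {R : realType} {X : pointedMetricType R}.

(* On a one-point space the regularity hypothesis is vacuous for every [s]; the
   bounds then hold with exponent 0. *)
Lemma ahlfors_regular_bounds (s : R) : 0 < s -> ahlfors_regular X s ->
  exists (rho : probability (g_sigma_algebraType (@open X)) R) (s' c r0 : R),
    [/\ 0 <= s', 1 <= c, 0 < r0 & forall (x : X) (r : R), 0 < r -> r <= r0 ->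
      ((c^-1 * r `^ s')%:E <= rho (metric_closed_ball mdist x r)
        <= (c * r `^ s')%:E)%E].
Proof.
move=> s0 [rho [c [c1 reg]]].
have [[x [y xy]]|same] := pselect (exists x y : X, 0 < mdist x y).
  exists rho, s, c, (mdist x y); split => //; first exact: ltW.
  move=> z r r0 rxy; apply: reg => //; apply: le_ereal_sup_tmp.
  by exists (mdist x y)%:E; [exists (x, y)|rewrite lee_fin].
exists rho, 0, 1, 1; split => // z r r0 _.
rewrite (_ : metric_closed_ball mdist z r = setT).
  by rewrite probability_setT powRr0 invr1 mulr1 lexx.
apply/seteqP; split => // y _; rewrite /metric_closed_ball/=.
apply: ltW; apply: le_lt_trans r0; rewrite leNgt; apply/negP => zy.
by apply: same; exists z, y.
Qed.

(** A maximal [r0]-separated list is a finite [r0]-net; the sum of its distances to [point] serves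
    as a crude maximum. *)
Lemma regular_bounded (rho : probability (g_sigma_algebraType (@open X)) R) (s c r0 : R) :
  1 <= c -> 0 < r0 -> (forall (x : X) (r : R), 0 < r -> r <= r0 ->
    ((c^-1 * r `^ s)%:E <= rho (metric_closed_ball mdist x r)
        <= (c * r `^ s)%:E)%E) ->
  exists D, forall a b : X, mdist a b <= D.
Proof.
move=> c1 r00 reg.
have [l [_ _ lz]] := maximal_separated c1 reg xpredT r00 (lexx r0).
pose B := \sum_(y <- l) mdist point y.
have lB (z : X) : mdist point z <= B + r0.
  have [y yl yz] := lz z isT; apply: le_trans (metric_triangle _ y _) _.
  rewrite lerD// /B (big_rem y)//= lerDl sumr_ge0// => i _; exact: mdist_ge0.
exists ((B + r0) *+ 2) => a b; apply: le_trans (metric_triangle _ point _) _.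
by rewrite mulr2n lerD// metric_sym.
Qed.

End ahlfors.

Theorem corollary1p4 (R : realType) (s : R) (hs : 0 < s)
    (X : pointedMetricType R) (hX : compact [set: X])
    (hreg : ahlfors_regular X s)
    (phi : (nat -> X) -> R)
    (hphi : holder_continuous (@seq_dist R X) phi)
    (hphi2 : depends_on_first_two phi) :
  upper_mmdim (@seq_dist R X) (@left_shift R X) phi =
    ereal_sup [set (lower_rdim (@left_shift R X) mu +
                    \int[mu]_x (phi x)%:E)%E
              | mu in [set mu : probability (borel (@seq_dist R X)) R |
                        invariant_measure (@left_shift R X) mu]]
  /\
  ereal_sup [set (lower_rdim (@left_shift R X) mu +
                  \int[mu]_x (phi x)%:E)%E
            | mu in [set mu : probability (borel (@seq_dist R X)) R |
                      invariant_measure (@left_shift R X) mu]] =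
    ereal_sup [set (upper_rdim (@left_shift R X) mu +
                    \int[mu]_x (phi x)%:E)%E
              | mu in [set mu : probability (borel (@seq_dist R X)) R |
                        invariant_measure (@left_shift R X) mu]].
Proof.
have [rho [s' [c [r0 [s0 c1 r00 reg]]]]] := ahlfors_regular_bounds hs hreg.
have [D mD] := regular_bounded c1 r00 reg.
have [M phiM] := holder_bounded mD hphi.
have mphi := measurable_holder mD hphi.
have phi_unif := fun eta => holder_uniform_coordinates mD hphi (eta := eta) r00.
have [beta [beta_ge beta_le]] := max_ergodic_average (@left_shift R X) phiM.
have mmdimE := upper_mmdim_shift c1 reg mD phiM phi_unif beta_ge beta_le.
set L := [set _ | mu in _]; set U := [set (upper_rdim _ _ + _)%E | mu in _].
have LU : (ereal_sup L <= ereal_sup U)%E.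
  apply: ge_ereal_sup => _ [mu mu_inv <-].
  apply: le_ereal_sup_tmp; exists (upper_rdim (@left_shift R X) mu + \int[mu]_x (phi x)%:E)%E.
    by exists mu.
  by apply: leeD => //; exact: limf_einf_le_esup.
have U_le : (ereal_sup U <= (s' + beta)%:E)%E.
  apply: ge_ereal_sup => _ [mu mu_inv <-]; rewrite EFinD leeD//.
    exact: (upper_rdim_le c1 r00 reg mD).
  exact: (integral_potential_le mD mu_inv phiM mphi).
have L_ge : ((s' + beta)%:E <= ereal_sup L)%E.
  apply/lee_subgt0Pr => eta eta0.
  have eta20 : 0 < eta / 2 by rewrite divr_gt0.
  have [mu [mu_inv mu1 mu2]] := near_optimal_measure hX s0 c1 r00 reg mD phiM hphi2 mphi phi_unif beta_ge eta20.
  apply: le_ereal_sup_tmp; exists (lower_rdim (@left_shift R X) mu + \int[mu]_x (phi x)%:E)%E.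
    by exists mu.
  apply: le_trans (leeD mu1 mu2); rewrite -EFinB -EFinD lee_fin; lra.
by rewrite mmdimE; split; apply/eqP; rewrite eq_le;
  [rewrite L_ge (le_trans LU)|rewrite LU (le_trans U_le)].
Qed.
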